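(* Let $\mathcal{S}\in\mathcal{A}$, with unit normal field $\mathbf{n}$, mean curvature $H$, unit conormal $\boldsymbol{\nu}$ along $\partial\mathcal{S}$, and $\mathcal{Y}=\partial\mathcal{S}\setminus\mathcal{W}$. Then $\mathcal{S}$ is a critical point of the free-energy functional $E$ if and only if $$H=0\quad\text{on }\mathcal{S}\qquad\text{and}\qquad \boldsymbol{\nu}=\mathbf{r}\quad\text{on }\mathcal{Y}.$$
   Context: Fix $\rho>0$ and $\theta_0\in[0,\pi)$. Let $\mathcal{C}=\{(x,y,z)\in\mathbb{R}^3: x^2+y^2=1,\ 0\le z\le\rho\}$, let $\mathbf{z}=(0,0,1)$, and let $\mathbf{r}(x,y,z)=(x,y,0)$ be the unit normal on $\mathcal{C}$ pointing away from its axis. Let $\mathcal{W}_1=\{(0,s,0):|s|\le1\}$, $\mathcal{W}_2=\{(-s\sin\theta_0,s\cos\theta_0,\rho):|s|\le 1\}$ and $\mathcal{W}=\mathcal{W}_1\cup\mathcal{W}_2$. Let $\mathcal{S}_0=\{(0,y,z):-1\le y\le 1,\ 0\le z\le\rho\}$. $\mathcal{A}$ is the collection of all surfaces $\mathcal{S}$ such that (1) there is an injective $f\in C^2(\mathcal{S}_0,\mathbb{R}^3)$ with $f(\mathcal{S}_0)=\mathcal{S}$; (2) the boundary $\partial\mathcal{S}$ consists of $\mathcal{W}$ and two curves lying on $\mathcal{C}$, i.e. $\mathcal{W}\subset\partial\mathcal{S}$ and $\mathcal{Y}:=\partial\mathcal{S}\setminus\mathcal{W}\subset\mathcal{C}$.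 Surfaces are understood to be regular, so that $\mathcal{S}\in\mathcal{A}$ is oriented by a unit normal field $\mathbf{n}$ of class $C^1$. Along $\partial\mathcal{S}$, $\mathbf{t}$ is the unit tangent and $\boldsymbol{\nu}$ (the ''binormal'') is the outward unit conormal (tangent to $\mathcal{S}$, orthogonal to $\partial\mathcal{S}$), with $\mathbf{t}=\mathbf{n}\times\boldsymbol{\nu}$ and $\mathbf{n}=\boldsymbol{\nu}\times\mathbf{t}$. $\nabla_{\mathcal{S}}$ denotes the surface gradient (gradient of the extension that is constant in the normal direction) and $\mathrm{div}_{\mathcal{S}}=\mathrm{tr}\,\nabla_{\mathcal{S}}$. The curvature tensor is $\mathbf{L}=-\nabla_{\mathcal{S}}\mathbf{n}$, and $H=\tfrac12\mathrm{tr}\,\mathbf{L}$. The functional is $E(\mathcal{S})=\int_{\mathcal{S}}\sigma\,\mathrm{da}$ with $\sigma>0$ a constant. The admissible velocities are $$V=\{\mathbf{v}\in C^2(\mathcal{S},\mathbb{R}^3): \mathbf{v}=(\mathbf{v}\cdot\mathbf{t})\mathbf{t}\text{ on }\mathcal{W},\ \mathbf{v}\cdot\mathbf{r}=0\text{ on }\mathcal{Y}\}.$$ The first variation of $E$ at $\mathcal{S}$ in the direction $\mathbf{v}$ is $$\int_{\mathcal{S}}\sigma\,\mathrm{div}_{\mathcal{S}}\mathbf{v}\,\mathrm{da}=-\int_{\mathcal{S}}2\sigma H(\mathbf{v}\cdot\mathbf{n})\,\mathrm{da}+\int_{\partial\mathcal{S}}\sigma(\mathbf{v}\cdot\boldsymbol{\nu})\,\mathrm{dl},$$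 and $\mathcal{S}$ is a critical point of $E$ if, by definition, the first variation vanishes for every $\mathbf{v}\in V$. *)

(* Defs.v *)
From HB Require Import structures.
From mathcomp Require Import all_boot all_order all_algebra.
From mathcomp Require Import all_classical all_reals all_analysis.

Set Implicit Arguments.
Unset Strict Implicit.
Unset Printing Implicit Defensive.
Import Order.TTheory GRing.Theory Num.Theory.
Import numFieldNormedType.Exports.

Local Open Scope classical_set_scope.
Local Open Scope ring_scope.

(* The reference rectangle S_0 = {(0, y, z)} is identified with a set of pairs
   (y, z), so that a surface is f @` S0 rho with f : R * R -> 'cV[R]_3.
   A field on the surface (velocity, normal, conormal) is represented by its
   pullback along the injective f, i.e. its value at p is the value of the
   field at f p.  Only the values on S0 rho matter: the functions
   are total, and a function of class C^k on the closed rectangle is one of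
   class C^k on an open neighbourhood of it; its derivatives up to order k on
   the rectangle are determined by its values there. *)

Section Vectors.
Context {R : realType}.
Implicit Types u w : 'cV[R]_3.

Definition vec3 (a b c : R) : 'cV[R]_3 := \col_i [:: a; b; c]`_i.

(* Euclidean; the library norm on 'cV[R]_3 is the sup norm. *)
Definition dot u w : R := \sum_i u i 0 * w i 0.

Definition enorm u : R := Num.sqrt (dot u u).

Definition cross u w : 'cV[R]_3 :=
  vec3 (u 1 0 * w 2 0 - u 2 0 * w 1 0)
       (u 2 0 * w 0 0 - u 0 0 * w 2 0)
       (u 0 0 * w 1 0 - u 1 0 * w 0 0).

End Vectors.

Section Regularity.
Context {R : realType} {V W : normedModType R}.

Fixpoint Ck (k : nat) (U : set V) (f : V -> W) : Prop :=
  if k is k'.+1 then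
    (forall p, U p -> differentiable f p) /\ (forall d, Ck k' U ('D_d f))
  else forall p, U p -> {for p, continuous f}.

Definition Ck_on (k : nat) (A : set V) (f : V -> W) : Prop :=
  exists U : set V, [/\ open U, A `<=` U & Ck k U f].

End Regularity.

Section Geometry.
Context {R : realType} (rho theta0 : R).

Definition cylinder : set 'cV[R]_3 :=
  [set x | x 0 0 ^+ 2 + x 1 0 ^+ 2 = 1 /\ 0 <= x 2 0 <= rho].

Definition radial (x : 'cV[R]_3) : 'cV[R]_3 := vec3 (x 0 0) (x 1 0) 0.

Definition W1 : set 'cV[R]_3 := [set vec3 0 s 0 | s in [set s : R | `|s| <= 1]].

Definition W2 : set 'cV[R]_3 :=
  [set vec3 (- s * sin theta0) (s * cos theta0) rho
     | s in [set s : R | `|s| <= 1]].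

Definition Wires : set 'cV[R]_3 := W1 `|` W2.

Definition S0 : set (R * R) := [set p | -1 <= p.1 <= 1 /\ 0 <= p.2 <= rho].

Definition bdS0 : set (R * R) :=
  [set p | S0 p /\ [\/ p.1 = -1, p.1 = 1, p.2 = 0 | p.2 = rho]].

(* The boundary of S0 without its four corners, where the surface has no
   well-defined conormal.  For an admissible surface the corners are mapped to
   the four endpoints of the wires, so none of them is mapped to Y below. *)
Definition edges : set (R * R) :=
  [set p | (`|p.1| = 1 /\ 0 < p.2 < rho) \/
           (`|p.1| < 1 /\ (p.2 = 0 \/ p.2 = rho))].

(* Meaningful on edges only. *)
Definition outer_normal (p : R * R) : R * R :=
  if `|p.1| < 1 then (0, if p.2 == 0 then -1 else 1) else (p.1, 0).

Section Surface.
Variable f : R * R -> 'cV[R]_3.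

Definition f_y (p : R * R) : 'cV[R]_3 := 'D_((1, 0) : R * R) f p.
Definition f_z (p : R * R) : 'cV[R]_3 := 'D_((0, 1) : R * R) f p.

Definition bdS : set 'cV[R]_3 := f @` bdS0.

Definition Y : set 'cV[R]_3 := bdS `\` Wires.

(* f is an admissible parametrization of S, i.e. a witness of S being in the
   collection A; cross (f_y p) (f_z p) != 0 is the regularity of S. *)
Definition admissible (S : set 'cV[R]_3) : Prop :=
  [/\ Ck_on 2 S0 f,
      {in S0 &, injective f},
      (forall p, S0 p -> cross (f_y p) (f_z p) != 0),
      f @` S0 = S &
      Wires `<=` bdS /\ Y `<=` cylinder].

Definition unit_normal (n : R * R -> 'cV[R]_3) : Prop :=
  Ck_on 1 S0 n /\
  forall p, S0 p ->
    [/\ enorm (n p) = 1, dot (n p) (f_y p) = 0 & dot (n p) (f_z p) = 0].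

(* nu p is the image under the differential of f at p of a vector d pointing
   out of S0, it has unit length, and it is orthogonal to the boundary curve,
   whose tangent is the image of the rotated outer normal of S0. *)
Definition outward_conormal (nu : R * R -> 'cV[R]_3) : Prop :=
  forall p, edges p ->
    let m := outer_normal p in
    [/\ exists d : R * R, 0 < d.1 * m.1 + d.2 * m.2 /\ nu p = 'D_d f p,
        enorm (nu p) = 1 &
        dot (nu p) ('D_((- m.2, m.1) : R * R) f p) = 0].

Section Calculus.
Variable n : R * R -> 'cV[R]_3.

(* Coordinates (p, s) of the point f p + s n p in a neighbourhood of the
   surface. *)
Definition normal_chart (q : R * R * R) : 'cV[R]_3 := f q.1 + q.2 *: n q.1.

(* Columns: partial derivatives in y, z, s. *)
Definition jac (g : R * R * R -> 'cV[R]_3) (q : R * R * R) : 'M[R]_3 :=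
  \matrix_(i, j)
    ([:: 'D_((1, 0, 0) : R * R * R) g q;
         'D_((0, 1, 0) : R * R * R) g q;
         'D_((0, 0, 1) : R * R * R) g q]`_j) i 0.

(* In the coordinates (p, s) the extension of u that is constant in the normal
   direction is (p, s) |-> u p; the chain rule gives its gradient with respect
   to the point of R^3. *)
Definition surface_grad (u : R * R -> 'cV[R]_3) (p : R * R) : 'M[R]_3 :=
  jac (fun q => u q.1) (p, 0) *m invmx (jac normal_chart (p, 0)).

Definition surface_div (u : R * R -> 'cV[R]_3) (p : R * R) : R :=
  \tr (surface_grad u p).

Definition curvature_tensor (p : R * R) : 'M[R]_3 := - surface_grad n p.

Definition mean_curvature (p : R * R) : R := \tr (curvature_tensor p) / 2.

Definition surface_integral (g : R * R -> R) : R :=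
  Rintegral (lebesgue_measure \x lebesgue_measure)%E S0
    (fun p => g p * enorm (cross (f_y p) (f_z p))).

Definition first_variation (sigma : R) (v : R * R -> 'cV[R]_3) : R :=
  surface_integral (fun p => sigma * surface_div v p).

Definition unit_tangent (nu : R * R -> 'cV[R]_3) (p : R * R) : 'cV[R]_3 :=
  cross (n p) (nu p).

(* The tangent is undefined at corners; there the condition on the wires is
   the limit of the one on the open edges. *)
Definition admissible_velocity (nu v : R * R -> 'cV[R]_3) : Prop :=
  [/\ Ck_on 2 S0 v,
      (forall p, edges p -> Wires (f p) ->
         v p = dot (v p) (unit_tangent nu p) *: unit_tangent nu p) &
      (forall p, bdS0 p -> Y (f p) -> dot (v p) (radial (f p)) = 0)].

Definition critical_point (sigma : R) (nu : R * R -> 'cV[R]_3) : Prop :=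
  forall v, admissible_velocity nu v -> first_variation sigma v = 0.

End Calculus.
End Surface.
End Geometry.

(* Main.v *)
Require Import Defs.
From HB Require Import structures.
From mathcomp Require Import all_boot all_order all_algebra.
From mathcomp Require Import all_classical all_reals all_analysis.
From mathcomp Require Import ring lra.

Set Implicit Arguments.
Unset Strict Implicit.
Unset Printing Implicit Defensive.
Import Order.TTheory GRing.Theory Num.Theory.
Import numFieldNormedType.Exports.

Local Open Scope classical_set_scope.
Local Open Scope ring_scope.

(** Let v be a velocity and write J for the determinant of n, f_y, f_z, the signed
    area element ([jacobian3]). The first variation is the integral over the
    rectangle of sigma |J| div_S v, and the surface divergence theorem reduces to
    Green's theorem there: J div_S v is the planar divergence of the field
    (det (v, f_z, n), det (v, n, f_y)), minus 2 H J (v . n)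
    ([surface_div_flux], [first_variationE]). The cancellations behind this identity
    are the symmetry of second derivatives ([derive_comm]) and the fact that the
    derivatives of n are tangential. The sign of J is constant ([orientation]), so
    the first variation is, up to a nonzero factor, the flux of that field through
    the four edges minus the integral of 2 H J (v . n).

    If H vanishes and the conormal is radial off the wires, then both terms vanish:
    the flux density at an edge point is a multiple of the component of v along the
    conormal, v is tangent to the wires, and v is tangent to the cylinder elsewhere
    ([stationary_critical]).

    Conversely, let the surface be critical. Velocities supported inside the
    rectangle force H to vanish ([critical_bending]). Cut-off translations along the
    axis and cut-off rotations about it are then admissible near any boundary point
    off the wires, and show that the conormal is orthogonal to the tangent plane of
    the cylinder, so it is plus or minus the radial vector ([critical_conormal]).

    The sign is a global matter: nothing keeps the surface inside the cylinder, so
    at a single point the conormal might well point towards the axis. It is decided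
    at the corners. A smooth boundary point cannot be an end of a wire
    ([wire_end_not_edge]): the boundary curve would have to run radially out of the
    solid cylinder, which contains the whole boundary. So the four corners of the
    rectangle are the preimages of the four ends of the wires ([corner_wire_end]).
    The distance to the axis is 1 off the wires and less than 1 on them away from
    their ends, so by connectedness an edge with one point off the wires has none on
    them ([free_edge]). At a corner where such an edge begins, the adjacent edge runs
    along a wire towards the axis, so going out of the surface across the free edge
    means going radially outwards ([corner_outward]). By continuity the sign is the
    same along the whole edge ([critical_conormal_outward]). *)

(** * Calculus of functions of class C^k *)

Section CkCalculus.
Context {R : realType} {V : normedModType R}.
Implicit Types (W : normedModType R) (U : set V) (k : nat).

(** The difference of the two functions vanishes near [p], so it is a
    little-o of the increment with zero differential. *)
Lemma near_eq_differentiable W (f g : V -> W) (p : V) :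
  (\forall q \near p, f q = g q) -> differentiable f p -> differentiable g p.
Proof.
move=> fg df.
have -> : g = f + (g - f) by rewrite addrC subrK.
apply: differentiableD => //.
have k0 : (g - f) \o shift p = cst ((g - f) p) + \0 +o_ (0 : V) id.
  have fgn : \forall h \near (0 : V), f (h + p) = g (h + p).
    by move: fg; rewrite (near_shift 0 p) subr0.
  apply: (eqaddoP _ _ _ _).2 => e e0; near=> h.
  have /= -> : ((g - f) \o shift p - (cst ((g - f) p) + \0)) h = 0.
    rewrite /= !fctE /= (nbhs_singleton fg) subrr addr0 subr0.
    suff -> : f (h + p) = g (h + p) by rewrite subrr.
    by near: h.
  by rewrite normr0; apply: mulr_ge0; [exact: ltW|exact: normr_ge0].
have c0 : continuous (\0 : V -> W) by move=> ?; exact: cst_continuous.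
by apply/diff_locallyP; rewrite (diff_unique c0 k0).
Unshelve. all: by end_near. Qed.

Lemma Ck_continuous W k U (f : V -> W) p : Ck k U f -> U p -> {for p, continuous f}.
Proof.
case: k => [|k] /=; first by move=> h /h.
by case=> h _ /h; exact: differentiable_continuous.
Qed.

Lemma Ck_differentiable W k U (f : V -> W) p :
  Ck k.+1 U f -> U p -> differentiable f p.
Proof. by case=> h _; exact: h. Qed.

Lemma CkD W k U (f : V -> W) d : Ck k.+1 U f -> Ck k U ('D_d f).
Proof. by case=> _; exact. Qed.

Lemma CkW W k U (f : V -> W) : Ck k.+1 U f -> Ck k U f.
Proof.
elim: k f => [|k IH] f; first by move=> hf p Up; exact: (Ck_continuous hf).
by case=> h1 h2; split=> // d; apply: IH; exact: h2.
Qed.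

Lemma Ck_subset W k U U' (f : V -> W) : U' `<=` U -> Ck k U f -> Ck k U' f.
Proof.
move=> UU'; elim: k f => [|k IH] f /=; first by move=> h p /UU'; exact: h.
by case=> h1 h2; split=> [p /UU'|d]; [exact: h1|exact: IH].
Qed.

(** Membership in [Ck] involves the values near each point only. This is
    what lets the formulas for the derivative of a sum or a product, valid
    on [U] only, feed the induction on [k]. *)
Lemma Ck_eq W k U (f g : V -> W) : open U -> (forall p, U p -> f p = g p) ->
  Ck k U f -> Ck k U g.
Proof.
move=> oU; elim: k f g => [|k IH] f g fg /=.
  move=> hf p Up; have fgn : {near p, f =1 g}.
    by have := open_nbhs_nbhs (conj oU Up); apply: filterS => q /fg.
  rewrite /prop_for /continuous_at -fg //.
  apply: cvg_trans (hf p Up); apply: near_eq_cvg.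
  exact: fgn.
have fgn p : U p -> \forall q \near p, f q = g q.
  by move=> Up; have := open_nbhs_nbhs (conj oU Up); apply: filterS => q /fg.
case=> h1 h2; split=> [p Up|d].
  by apply: near_eq_differentiable (h1 p Up); exact: fgn.
by apply: IH (h2 d) => p Up; apply: near_eq_derive; exact: fgn.
Qed.

Lemma Ck_cst W k U (c : W) : Ck k U (fun=> c).
Proof.
elim: k c => [|k IH] c /=; first by move=> p _; exact: cst_continuous.
split=> [p _|d]; first exact: differentiable_cst.
rewrite (_ : 'D_d _ = fun=> 0); first exact: IH.
by apply/funext => p; rewrite derive_cst.
Qed.

Lemma Ck_linear W k U (f : {linear V -> W}) : continuous f -> Ck k U f.
Proof.
move=> cf; case: k => [|k] /=; first by move=> p _; exact: cf.
split=> [p _|d]; first exact: linear_differentiable.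
rewrite (_ : 'D_d _ = fun=> f d); first exact: Ck_cst.
by apply/funext => p; rewrite deriveE ?diff_lin//; exact: linear_differentiable.
Qed.

Lemma Ck_add W k U (f g : V -> W) : open U ->
  Ck k U f -> Ck k U g -> Ck k U (fun p => f p + g p).
Proof.
move=> oU; elim: k f g => [|k IH] f g /=.
  by move=> hf hg p Up; apply: continuousD; [exact: hf|exact: hg].
case=> f1 f2 [g1 g2]; split=> [p Up|d].
  by apply: differentiableD; [exact: f1|exact: g1].
apply: (Ck_eq (f := fun p => 'D_d f p + 'D_d g p)) => //; last exact: IH.
move=> p Up; rewrite -deriveD//; apply: diff_derivable; [exact: f1|exact: g1].
Qed.

Lemma Ck_mul k U (f g : V -> R) : open U ->
  Ck k U f -> Ck k U g -> Ck k U (fun p => f p * g p).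
Proof.
move=> oU; elim: k f g => [|k IH] f g.
  by move=> hf hg p Up; apply: continuousM; [exact: hf|exact: hg].
move=> hf hg; have [f1 f2] := hf; have [g1 g2] := hg.
split=> [p Up|d].
  by apply: differentiableM; [exact: f1|exact: g1].
apply: (Ck_eq (f := fun p => f p * 'D_d g p + g p * 'D_d f p)) => //.
  by move=> p Up; rewrite -deriveM//; apply: diff_derivable; [exact: f1|exact: g1].
by apply: Ck_add => //; [exact: IH (CkW hf) (g2 d)|exact: IH (CkW hg) (f2 d)].
Qed.

Lemma Ck_opp k U (f : V -> R) : open U -> Ck k U f -> Ck k U (fun p => - f p).
Proof.
move=> oU hf; apply: (Ck_eq (f := fun p => -1 * f p)) => //.
  by move=> p _; rewrite mulN1r.
by apply: Ck_mul => //; exact: Ck_cst.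
Qed.

Lemma Ck_sub k U (f g : V -> R) : open U ->
  Ck k U f -> Ck k U g -> Ck k U (fun p => f p - g p).
Proof. by move=> oU hf hg; apply: Ck_add => //; exact: Ck_opp. Qed.

Lemma Ck_scalel W k U (g : V -> R) (c : W) : open U ->
  Ck k U g -> Ck k U (fun p => g p *: c).
Proof.
move=> oU; elim: k g => [|k IH] g /=.
  by move=> hg p Up; apply: continuousZr_tmp; exact: hg.
case=> h1 h2; split=> [p Up|d].
  by apply: differentiableZl; exact: h1.
apply: (Ck_eq (f := fun p => 'D_d g p *: c)) => //; last exact: IH.
move=> p Up; have dg := h1 p Up.
by rewrite deriveE// deriveE ?diffZl//; exact: differentiableZl.
Qed.

Lemma derive_coord m n (f : V -> 'M[R]_(m, n)) p d i j : derivable f p d ->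
  'D_d (fun q => f q i j) p = 'D_d f p i j.
Proof. by move=> hf; rewrite derive_mx// mxE. Qed.

Lemma Ck_coord m n k U (f : V -> 'M[R]_(m.+1, n.+1)) i j : open U ->
  Ck k U f -> Ck k U (fun p => f p i j).
Proof.
move=> oU; elim: k f => [|k IH] f /=.
  move=> hf p Up; apply: (@continuous_comp _ _ _ f (fun M : 'M[R]_(_, _) => M i j)).
    exact: hf.
  exact: coord_continuous.
case=> h1 h2; split=> [p Up|d].
  apply: (@differentiable_comp _ _ _ _ f (fun M : 'M[R]_(_, _) => M i j)).
    exact: h1.
  exact: differentiable_coord.
apply: (Ck_eq (f := fun p => 'D_d f p i j)) => //; last exact: IH.
by move=> p Up; rewrite derive_coord//; apply: diff_derivable; exact: h1.
Qed.

End CkCalculus.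

(** * Lines, and the symmetry of second derivatives *)

Section Lines.
Context {R : realType} {V W : normedModType R}.

Lemma growth_along_line (f : V -> W) (p a : V) (s h : R) :
  h^-1 *: (f ((h *: 1 + s) *: a + p) - f (s *: a + p)) =
  h^-1 *: (f (h *: a + (s *: a + p)) - f (s *: a + p)).
Proof. by rewrite (mulr1 h : h *: 1 = h) scalerDl addrA. Qed.

(** Restriction to a line turns directional derivatives into ordinary ones,
    to which the mean value theorem applies. *)
Lemma is_derive_line (f : V -> W) (p a : V) (s : R) :
  differentiable f (s *: a + p) ->
  is_derive s 1 (fun t : R => f (t *: a + p)) ('D_a f (s *: a + p)).
Proof.
move=> /(@diff_derivable _ _ _ _ _ a) df; split.
  by rewrite /derivable; under eq_fun do rewrite growth_along_line.
by rewrite /derive; under eq_fun do rewrite growth_along_line.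
Qed.

End Lines.

Section Schwarz.
Context {R : realType} {V : normedModType R}.
Variables (U : set V) (f : V -> R) (p : V).
Hypotheses (oU : open U) (f2 : Ck 2 U f) (Up : U p).

Let second_difference (a b : V) (h : R) : R :=
  f (h *: a + (h *: b + p)) - f (h *: a + p) - (f (h *: b + p) - f p).

(** Two applications of the mean value theorem, first along [a] and then
    along [b], express the second difference as a mixed derivative at a
    point of the small parallelogram; continuity moves that point to [p]. *)
Let second_difference_approx (a b : V) (e : R) : 0 < e ->
  \forall h \near 0^'+, `|second_difference a b h - h ^+ 2 * 'D_b ('D_a f) p| <= h ^+ 2 * e.
Proof.
move=> e0.
have f1 q : U q -> differentiable f q by exact: (Ck_differentiable f2).
have fa q : U q -> differentiable ('D_a f) q.
  by exact: (Ck_differentiable (CkD a f2)).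
have fc : {for p, continuous ('D_b ('D_a f))}.
  exact: (Ck_continuous (CkD b (CkD a f2)) Up).
have : \forall q \near p, U q /\ `|'D_b ('D_a f) q - 'D_b ('D_a f) p| < e.
  by apply: filterI; [exact: open_nbhs_nbhs|move/cvgrPdistC_lt : fc; apply].
move=> /nbhs_ballP[r /= r0 hr].
(* The norms of [a] and [b] convert the radius into a bound on [h]; the summand
   [1] covers the case of zero vectors. *)
have M0 : 0 < `|a| + `|b| + 1 by rewrite ltr_wpDl// addr_ge0.
near=> h.
have h0 : 0 < h by near: h; exact: nbhs_right_gt.
have hM : h * (`|a| + `|b| + 1) < r.
  by rewrite -ltr_pdivlMr//; near: h; apply: nbhs_right_lt; rewrite divr_gt0.
have near_p s t : 0 <= s <= h -> 0 <= t <= h ->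
    U (s *: a + (t *: b + p)) /\
    `|'D_b ('D_a f) (t *: b + (s *: a + p)) - 'D_b ('D_a f) p| < e.
  move=> /andP[s0 sh] /andP[t0 th].
  rewrite (addrCA (t *: b)); apply: hr; rewrite -ball_normE /ball_/=.
  rewrite addrA opprD addrCA subrr addr0 normrN.
  apply: le_lt_trans hM; apply: le_trans (ler_normD _ _) _.
  rewrite !normrZ !ger0_norm// 2!mulrDr mulr1 -[leLHS]addr0.
  apply: lerD; last exact: ltW.
  by apply: lerD; apply: ler_wpM2r.
have hh : 0 <= h <= h by apply/andP; split=> //; exact: ltW.
have oh : 0 <= (0 : R) <= h by apply/andP; split=> //; exact: ltW.
have dphi s : s \in `[0, h]%R -> is_derive s 1
    (fun t => f (t *: a + (h *: b + p)) - f (t *: a + p))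
    ('D_a f (s *: a + (h *: b + p)) - 'D_a f (s *: a + p)).
  rewrite in_itv/= => sh; apply: is_deriveB; apply: is_derive_line; apply: f1.
    by have [] := near_p _ _ sh hh.
  by have [] := near_p _ _ sh oh; rewrite scale0r add0r.
have [s sh /= Es] : exists2 s, s \in `]0, h[%R &
   second_difference a b h =
     ('D_a f (s *: a + (h *: b + p)) - 'D_a f (s *: a + p)) * h.
  have cphi : {within `[0, h], continuous
      (fun t => f (t *: a + (h *: b + p)) - f (t *: a + p))}.
    by apply: derivable_within_continuous => s; move=> /dphi[].
  have [s sI] := MVT h0 (fun s sI => dphi s (subset_itv_oo_cc sI)) cphi.
  by rewrite /= !scale0r !add0r subr0 => E; exists s.
have sI : 0 <= s <= h by move: sh; rewrite in_itv/= => /andP[/ltW-> /ltW->].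
have dpsi t : t \in `[0, h]%R -> is_derive t 1
    (fun t => 'D_a f (t *: b + (s *: a + p)))
    ('D_b ('D_a f) (t *: b + (s *: a + p))).
  rewrite in_itv/= => tI; apply: is_derive_line; apply: fa.
  by rewrite addrCA; have [] := near_p _ _ sI tI.
have [t th /= Et] : exists2 t, t \in `]0, h[%R &
   'D_a f (s *: a + (h *: b + p)) - 'D_a f (s *: a + p) =
     'D_b ('D_a f) (t *: b + (s *: a + p)) * h.
  have cpsi : {within `[0, h], continuous
      (fun t => 'D_a f (t *: b + (s *: a + p)))}.
    by apply: derivable_within_continuous => t; move=> /dpsi[].
  have [t tI] := MVT h0 (fun t tI => dpsi t (subset_itv_oo_cc tI)) cpsi.
  by rewrite /= !scale0r !add0r subr0 addrCA => E; exists t.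
have tI : 0 <= t <= h by move: th; rewrite in_itv/= => /andP[/ltW-> /ltW->].
have [_ close] := near_p _ _ sI tI.
have h2 : 0 <= h ^+ 2 by exact/exprn_ge0/ltW.
rewrite Es Et -mulrA -expr2 [_ * h ^+ 2]mulrC -mulrBr normrM (ger0_norm h2).
exact: (ler_wpM2l h2 (ltW close)).
Unshelve. all: by end_near. Qed.

(** Both mixed derivatives are the limit of the same quotient, the second
    difference over the parallelogram spanned by [h a] and [h b] divided by
    [h ^+ 2]. *)
Lemma derive_comm (a b : V) : 'D_b ('D_a f) p = 'D_a ('D_b f) p.
Proof.
have := second_difference_approx b a; have := second_difference_approx a b.
move: ('D_b ('D_a f) p) ('D_a ('D_b f) p) => x y Fx Fy.
apply/eqP; rewrite -subr_eq0 -normr_le0; apply/ler_addgt0Pl => e e0.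
have e2 : 0 < e / 2 by rewrite divr_gt0.
rewrite addr0.
have : \forall h \near (0 : R)^'+, [/\ 0 < h,
    `|second_difference a b h - h ^+ 2 * x| <= h ^+ 2 * (e / 2) &
    `|second_difference b a h - h ^+ 2 * y| <= h ^+ 2 * (e / 2)].
  by apply: filterS3 (nbhs_right_gt (0 : R)) (Fx _ e2) (Fy _ e2); split.
move=> /filter_ex[h [h0]].
have C : second_difference b a h = second_difference a b h.
  by rewrite /second_difference (addrCA (h *: b)) !opprB addrACA [RHS]addrACA [- _ - _]addrC.
rewrite C.
move: (second_difference a b h) => z A B.
have h2 : 0 < h ^+ 2 by rewrite exprn_gt0.
rewrite -(ler_pM2l h2) -[X in X * `|_|](ger0_norm (ltW h2)) -normrM mulrBr.
have -> : h ^+ 2 * x - h ^+ 2 * y = (z - h ^+ 2 * y) - (z - h ^+ 2 * x) by ring.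
apply: le_trans (ler_normB _ _) _; apply: le_trans (lerD B A) _.
by rewrite -mulrDr -splitr.
Qed.

End Schwarz.

Section Plane.
Context {R : realType}.

Lemma pair_dy (t y z : R) : t *: ((1, 0) : R * R) + (y, z) = (t + y, z).
Proof.
by congr pair => /=; rewrite ?(mulr1 t : t *: 1 = t) ?(mulr0 t : t *: 0 = 0) ?add0r.
Qed.

Lemma pair_dz (t y z : R) : t *: ((0, 1) : R * R) + (y, z) = (y, t + z).
Proof.
by congr pair => /=; rewrite ?(mulr1 t : t *: 1 = t) ?(mulr0 t : t *: 0 = 0) ?add0r.
Qed.

Lemma pair_dyN (t y z : R) : t *: ((-1, 0) : R * R) + (y, z) = (y - t, z).
Proof.
congr pair => /=; last by rewrite (mulr0 t : t *: 0 = 0) add0r.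
by rewrite (mulrN1 t : t *: -1 = - t) addrC.
Qed.

Lemma pair_dzN (t y z : R) : t *: ((0, -1) : R * R) + (y, z) = (y, z - t).
Proof.
congr pair => /=; first by rewrite (mulr0 t : t *: 0 = 0) add0r.
by rewrite (mulrN1 t : t *: -1 = - t) addrC.
Qed.

End Plane.

(** * Truncated powers *)

Section Bump.
Context {R : realType}.

Let pos (t : R) : R := Num.max 0 t.

Let posE t : 0 < t -> pos t = t.
Proof. by move=> t0; rewrite /pos max_r// ltW. Qed.

Let pos0 t : t <= 0 -> pos t = 0.
Proof. by move=> t0; rewrite /pos max_l. Qed.

Let pos_continuous : continuous pos.
Proof.
move=> t; apply: (@continuous_max _ _ (fun=> 0) id t); first exact: cst_continuous.
exact: cvg_id.
Qed.

(** Away from the origin this is a power or a constant; at the origin the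
    difference quotient is at most [`|h|] for small [h]. *)
Lemma is_derive_posX (k : nat) (t : R) :
  is_derive t 1 (fun s => pos s ^+ k.+2) (k.+2%:R * pos t ^+ k.+1).
Proof.
have [t0|t0|->] := ltgtP t 0.
- rewrite (pos0 (ltW t0)) expr0n/= mulr0.
  apply: near_eq_is_derive (is_derive_cst (0 : R) t 1).
  near=> s; rewrite pos0 ?expr0n//; apply: ltW; near: s; exact: lt_nbhsl.
- rewrite (posE t0).
  have dX : is_derive t 1 (fun s : R => s ^+ k.+2) (k.+2%:R * t ^+ k.+1).
    split; first exact: exprn_derivable.
    by rewrite -derive1E exp_derive1.
  apply: near_eq_is_derive dX.
  by near=> s; rewrite posE//; near: s; exact: lt_nbhsr.
- rewrite (pos0 (lexx 0)) expr0n/= mulr0.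
  have cv : (fun h : R => h^-1 *: (pos (h *: 1 + 0) ^+ k.+2 - pos 0 ^+ k.+2)) @ 0^'
     --> (0 : R).
    apply/cvgrPdist_le => e e0; near=> h.
    have h0 : h != 0 by near: h; exact: nbhs_dnbhs_neq.
    have he : `|h| < Num.min e 1.
      by near: h; apply: dnbhs0_lt; rewrite lt_min e0 ltr01.
    move: he; rewrite lt_min => /andP[he h1].
    rewrite (pos0 (lexx 0)) expr0n/= subr0 sub0r normrN addr0.
    rewrite (mulr1 h : h *: 1 = h) normrM normfV.
    rewrite ler_pdivrMl ?normr_gt0// normrX.
    have ph : `|pos h| <= `|h|.
      by have [hn|hn] := leP h 0; rewrite ?(pos0 hn) ?(posE hn) ?normr0.
    apply: (@le_trans _ _ (`|h| ^+ k.+2)); first exact: lerXn2r.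
    rewrite exprS ler_wpM2l// exprS; apply: le_trans (ltW he).
    by rewrite ler_piMr// exprn_ile1// ltW.
  by split; [apply/cvg_ex; exists 0|apply/cvg_lim].
Unshelve. all: by end_near. Qed.

Context {V : normedModType R}.

(** Each power beyond the first buys one derivative, since the derivative of
    the truncated power is the next lower one. *)
Lemma Ck_posX k (U : set V) (g : V -> R) : open U -> Ck k U g ->
  Ck k U (fun p => Num.max 0 (g p) ^+ k.+1).
Proof.
move=> oU; elim: k => [|k IH].
  have -> : (fun p => Num.max 0 (g p) ^+ 1) = pos \o g by [].
  by move=> gc p Up; apply: continuous_comp; [exact: gc|exact: pos_continuous].
move=> hg; have gk := CkW hg.
have gd p (Up : U p) := Ck_differentiable hg Up.
have dpos t : differentiable (fun s => pos s ^+ k.+2) t.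
  by apply/derivable1_diffP; case: (is_derive_posX k t).
have dcomp p : U p -> differentiable (fun q => pos (g q) ^+ k.+2) p.
  move=> Up.
  exact: (@differentiable_comp _ _ _ _ g (fun s => pos s ^+ k.+2) _ (gd p Up)).
split=> // d.
apply: (Ck_eq (f := fun p => k.+2%:R * pos (g p) ^+ k.+1 * 'D_d g p)) => //.
  move=> p Up.
  rewrite deriveE ?[in RHS]deriveE; [|exact: dcomp|exact: gd].
  rewrite (@diff_comp _ _ _ _ g (fun s => pos s ^+ k.+2) _ (gd p Up) (dpos _)) /=.
  rewrite deriv1E; last by case: (is_derive_posX k (g p)).
  rewrite derive1E; case: (is_derive_posX k (g p)) => _ ->.
  by rewrite mulrC.
apply: Ck_mul => //; last exact: CkD.
by apply: Ck_mul => //; [exact: Ck_cst|exact: IH].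
Qed.

End Bump.

(** * Integration over a rectangle *)

Section ProductMeasurability.
Context {R : realType}.
Let T := (measurableTypeR R * measurableTypeR R)%type.

Let box (a b r : rat) : set (R * R) :=
  `](ratr a - ratr r), (ratr a + ratr r)[%classic `*`
  `](ratr b - ratr r), (ratr b + ratr r)[%classic.

Let mbox a b r : measurable (box a b r : set T).
Proof. by apply: measurableX; exact: measurable_itv. Qed.

Let box_in_ball (x : R * R) (e : R) : 0 < e ->
  exists a b r : rat, box a b r x /\ box a b r `<=` ball x e.
Proof.
move=> e0.
have /rat_in_itvoo[r] : (0 : R) < e / 2 by rewrite divr_gt0.
rewrite in_itv/= => /andP[r0 re].
have /rat_in_itvoo[a] : x.1 - ratr r < x.1 + ratr r by rewrite ltrBlDr -addrA ltrDl addr_gt0.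
rewrite in_itv/= => /andP[a1 a2].
have /rat_in_itvoo[b] : x.2 - ratr r < x.2 + ratr r by rewrite ltrBlDr -addrA ltrDl addr_gt0.
rewrite in_itv/= => /andP[b1 b2].
exists a, b, r; split.
  by split; rewrite /= in_itv/=; apply/andP; split; lra.
move=> [y z] [] /=; rewrite !in_itv/= => /andP[y1 y2] /andP[z1 z2].
by split; rewrite /ball /= ltr_norml; apply/andP; split; lra.
Qed.

(** An open set of the plane is the union of the rational boxes inside it,
    and there are countably many of them. *)
Lemma open_measurable_prod (U : set (R * R)) : open U -> measurable (U : set T).
Proof.
move=> oU.
have -> : U = \bigcup_a \bigcup_b \bigcup_r
    (if pselect (box a b r `<=` U) then box a b r else set0).
  apply/seteqP; split=> [x Ux|x [a _ [b _ [r _]]]]; last first.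
    by case: pselect => // h /h.
  have /nbhs_ballP[e /= e0 he] := open_nbhs_nbhs (conj oU Ux).
  have [a [b [r [xb be]]]] := box_in_ball x e0.
  exists a => //; exists b => //; exists r => //.
  by case: pselect => // -[]; exact: subset_trans be he.
apply: bigcupT_measurable_rat => a; apply: bigcupT_measurable_rat => b.
apply: bigcupT_measurable_rat => r.
by case: pselect => h; [exact: mbox|exact: measurable0].
Qed.

Lemma continuous_measurable_prod (U D : set (R * R)) (g : R * R -> R) :
  open U -> measurable (D : set T) -> D `<=` U -> Ck 0 U g ->
  measurable_fun (D : set T) (g : T -> measurableTypeR R).
Proof.
move=> oU mD DU cg.
apply: (measurability _ (measurable_realfun.RGenOInfty.measurableE R)).
move=> /= _ [_ [x ->]] <-.
have -> : D `&` g @^-1` `]x, +oo[%classic = D `&` [set p | U p /\ x < g p].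
  apply/seteqP; split=> p [Dp /=]; rewrite in_itv/= andbT => h; split => //.
    by split=> //; exact: DU.
  by case: h.
apply: measurableI => //; apply: open_measurable_prod.
rewrite openE => p [Up xp]; rewrite /interior.
apply: filterI; first exact: open_nbhs_nbhs.
exact: (cvgr_gt _ (cg p Up)).
Qed.

End ProductMeasurability.

Section Rectangle.
Context {R : realType}.
Variables (a b c d : R) (U : set (R * R)).
Hypotheses (ab : a < b) (cd : c < d) (oU : open U).
Let T := (measurableTypeR R * measurableTypeR R)%type.
Let mu : {sigma_finite_measure set (measurableTypeR R) -> \bar R} := @lebesgue_measure R.
Let rect : set (R * R) := `[a, b]%classic `*` `[c, d]%classic.
Hypothesis rectU : rect `<=` U.

Lemma rect_measurable : measurable (rect : set T).
Proof. by apply: measurableX; exact: measurable_itv. Qed.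

Lemma rect_compact : compact rect.
Proof. by apply: compact_setX; exact: segment_compact. Qed.

Lemma integrable_rect (g : R * R -> R) : Ck 0 U g ->
  (mu \x mu)%E.-integrable (rect : set T) (EFin \o g).
Proof.
move=> cg; apply: measurable_bounded_integrable; first exact: rect_measurable.
- have E : (mu \x mu)%E rect = (mu `[a, b]%classic * mu `[c, d]%classic)%E.
    by apply: product_measure1E; exact: measurable_itv.
  have fin : ((mu \x mu) rect < +oo)%E.
    rewrite E /mu/= !lebesgue_measure_itv/= !lte_fin ab cd.
    by rewrite -!EFinB -EFinM ltry.
  exact: fin.
- by apply: (continuous_measurable_prod oU) => //; exact: rect_measurable.
- have gc : {within rect, continuous g}.
    by apply: continuous_in_subspaceT => p /set_mem /rectU /cg.
  have /compact_bounded[M [_ mrt]] := continuous_compact gc rect_compact.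
  by exists M; split; rewrite ?num_real // => ? ? ? ?; apply: mrt => //; exists x.
Qed.

(** Integrate in the first variable first, where the fundamental theorem of
    calculus applies. *)
Lemma integral_dy_rect (P : R * R -> R) : Ck 1 U P ->
  (\int[mu \x mu]_(p in rect) ('D_((1, 0) : R * R) P p)%:E =
   \int[mu]_(z in `[c, d]) (P (b, z) - P (a, z))%:E)%E.
Proof.
move=> cP; have iP := integrable_rect (CkD ((1, 0) : R * R) cP).
have iP' := (integrable_mkcond _ rect_measurable).1 iP.
rewrite integral_mkcond -(integral21_prod_meas1 iP').
rewrite [RHS]integral_mkcond; apply: eq_integral => z _.
rewrite /fubini_G patchE; case: ifPn => [/set_mem zcd|zcd]; last first.
  rewrite integral0_eq// => x _; rewrite patchE ifN//.
  by apply/negP => /set_mem[_ /mem_set]; apply/negP.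
have EQ x : ((fun p : T => ('D_((1, 0) : R * R) P p)%:E) \_ rect) (x, z) =
   ((fun x => ('D_((1, 0) : R * R) P (x, z))%:E) \_ `[a, b]%classic) x.
  rewrite !patchE; congr (if _ then _ else _); apply/idP/idP => /set_mem h.
    by apply/mem_set; case: h.
  by apply/mem_set; split.
under eq_integral do rewrite EQ.
rewrite -integral_mkcond.
have dP x : a <= x <= b -> is_derive x 1 (fun x => P (x, z)) ('D_((1, 0) : R * R) P (x, z)).
  move=> xab; have := @is_derive_line _ _ _ P (0, z) ((1, 0) : R * R) x.
  have E t : t *: ((1, 0) : R * R) + (0, z) = (t, z) by rewrite pair_dy addr0.
  rewrite E; under eq_fun do rewrite E.
  by apply; apply: (Ck_differentiable cP); apply: rectU; split.
have cF x : a <= x <= b -> {for x, continuous (fun x => P (x, z))}.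
  move=> /dP[dx _]; apply: differentiable_continuous.
  exact/derivable1_diffP.
rewrite (@continuous_FTC2 _ _ (fun x => P (x, z)) a b ab) ?EFinB//.
- apply: continuous_in_subspaceT => x /set_mem xab.
  have cD : {for (x, z), continuous ('D_((1, 0) : R * R) P)}.
    by apply: (Ck_continuous (CkD _ cP)); apply: rectU; split.
  have cz : {for x, continuous (fun x => (x, z))}.
    exact: (cvg_pair cvg_id (cvg_cst z)).
  exact: (continuous_comp cz cD).
- split.
  + by move=> x /subset_itv_oo_cc; rewrite in_itv/= => /dP[].
  + by apply: cvg_at_right_filter; apply: cF; rewrite lexx ltW.
  + by apply: cvg_at_left_filter; apply: cF; rewrite lexx ltW.
- by move=> x /subset_itv_oo_cc; rewrite in_itv/= derive1E => /dP[].
Qed.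

Lemma integral_dz_rect (Q : R * R -> R) : Ck 1 U Q ->
  (\int[mu \x mu]_(p in rect) ('D_((0, 1) : R * R) Q p)%:E =
   \int[mu]_(z in `[a, b]) (Q (z, d) - Q (z, c))%:E)%E.
Proof.
move=> cQ; have iQ := integrable_rect (CkD ((0, 1) : R * R) cQ).
have iQ' := (integrable_mkcond _ rect_measurable).1 iQ.
rewrite integral_mkcond -(integral12_prod_meas1 iQ').
rewrite [RHS]integral_mkcond; apply: eq_integral => z _.
rewrite /fubini_F patchE; case: ifPn => [/set_mem zab|zab]; last first.
  rewrite integral0_eq// => x _; rewrite patchE ifN//.
  by apply/negP => /set_mem[/mem_set + _]; apply/negP.
have EQ x : ((fun p : T => ('D_((0, 1) : R * R) Q p)%:E) \_ rect) (z, x) =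
   ((fun x => ('D_((0, 1) : R * R) Q (z, x))%:E) \_ `[c, d]%classic) x.
  rewrite !patchE; congr (if _ then _ else _); apply/idP/idP => /set_mem h.
    by apply/mem_set; case: h.
  by apply/mem_set; split.
under eq_integral do rewrite EQ.
rewrite -integral_mkcond.
have dQ x : c <= x <= d -> is_derive x 1 (fun x => Q (z, x)) ('D_((0, 1) : R * R) Q (z, x)).
  move=> xcd; have := @is_derive_line _ _ _ Q (z, 0) ((0, 1) : R * R) x.
  have E t : t *: ((0, 1) : R * R) + (z, 0) = (z, t) by rewrite pair_dz addr0.
  rewrite E; under eq_fun do rewrite E.
  by apply; apply: (Ck_differentiable cQ); apply: rectU; split.
have cF x : c <= x <= d -> {for x, continuous (fun x => Q (z, x))}.
  move=> /dQ[dx _]; apply: differentiable_continuous.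
  exact/derivable1_diffP.
rewrite (@continuous_FTC2 _ _ (fun x => Q (z, x)) c d cd) ?EFinB//.
- apply: continuous_in_subspaceT => x /set_mem xcd.
  have cD : {for (z, x), continuous ('D_((0, 1) : R * R) Q)}.
    by apply: (Ck_continuous (CkD _ cQ)); apply: rectU; split.
  have cz : {for x, continuous (fun x => (z, x))}.
    exact: (cvg_pair (cvg_cst z) cvg_id).
  exact: (continuous_comp cz cD).
- split.
  + by move=> x /subset_itv_oo_cc; rewrite in_itv/= => /dQ[].
  + by apply: cvg_at_right_filter; apply: cF; rewrite lexx ltW.
  + by apply: cvg_at_left_filter; apply: cF; rewrite lexx ltW.
- by move=> x /subset_itv_oo_cc; rewrite in_itv/= derive1E => /dQ[].
Qed.


(** Green's theorem for a rectangle. *)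
Lemma divergence_rect (P Q : R * R -> R) : Ck 1 U P -> Ck 1 U Q ->
  Rintegral (mu \x mu)%E rect
    (fun p => 'D_((1, 0) : R * R) P p + 'D_((0, 1) : R * R) Q p) =
  Rintegral mu `[c, d] (fun z => P (b, z) - P (a, z)) +
  Rintegral mu `[a, b] (fun y => Q (y, d) - Q (y, c)).
Proof.
move=> cP cQ.
have iP := integrable_rect (CkD ((1, 0) : R * R) cP).
have iQ := integrable_rect (CkD ((0, 1) : R * R) cQ).
rewrite (RintegralD rect_measurable iP iQ).
by rewrite /Rintegral integral_dy_rect// integral_dz_rect.
Qed.

End Rectangle.

Section Positivity.
Context d (T : measurableType d) {R : realType} (m : {measure set T -> \bar R}).

(** A nonnegative integrand that exceeds a positive constant on a set of
    positive measure has positive integral. *)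
Lemma Rintegral_gt0 (D B : set T) (g : T -> R) (e : R) :
  measurable D -> measurable B -> B `<=` D -> (0 < m B)%E ->
  m.-integrable D (EFin \o g) -> 0 < e ->
  (forall x, D x -> 0 <= g x) -> (forall x, B x -> e <= g x) ->
  0 < Rintegral m D g.
Proof.
move=> mD mB BD mB0 ig e0 g0 ge.
have mg := measurable_int _ ig.
rewrite /Rintegral; apply: fine_gt0; apply/andP; split; last first.
  by rewrite ltey_eq (integrable_fin_num mD ig).
apply: (@lt_le_trans _ _ (e%:E * m B)%E); first by rewrite mule_gt0.
rewrite -(integral_cst m mB) /=.
apply: (@le_trans _ _ (\int[m]_(x in B) (g x)%:E)%E).
  apply: ge0_le_integral => //.
  - by move=> x _; rewrite lee_fin ltW.
  - exact: measurable_funS mg.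
by apply: ge0_subset_integral.
Qed.

End Positivity.

Section PositivityOnIntervals.
Context {R : realType}.
Let mu : {sigma_finite_measure set (measurableTypeR R) -> \bar R} := @lebesgue_measure R.

Let subitv (a b x r : R) : a < x < b -> 0 < r -> exists2 s : R, 0 < s &
  `]x - s, x + s[%classic `<=` `[a, b]%classic `&` ball x r.
Proof.
move=> /andP[ax xb] r0; exists (Num.min r (Num.min (x - a) (b - x))).
  by rewrite !lt_min r0 !subr_gt0 ax xb.
set s := Num.min _ _ => y; rewrite /= in_itv/= => /andP[y1 y2].
have : s <= r /\ s <= x - a /\ s <= b - x.
  by rewrite /s !ge_min !lexx !orbT.
move=> [s1 [s2 s3]]; split; first by rewrite in_itv/=; apply/andP; split; lra.
by rewrite /ball /= ltr_norml; apply/andP; split; lra.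
Qed.

Let subitv_gt0 (x s : R) : 0 < s -> (0 < mu `](x - s)%R, (x + s)%R[%classic)%E.
Proof.
move=> s0; rewrite /mu/= lebesgue_measure_itv/= lte_fin ifT; last by lra.
by rewrite -EFinB lte_fin; lra.
Qed.

Lemma Rintegral_itv_gt0 (a b : R) (g : R -> R) (x : R) :
  (forall y, a <= y <= b -> {for y, continuous g}) ->
  (forall y, a <= y <= b -> 0 <= g y) -> a < x < b -> 0 < g x ->
  0 < Rintegral mu `[a, b] g.
Proof.
move=> cg g0 xab gx.
have xab' : a <= x <= b by case/andP: xab => /ltW-> /ltW->.
have gx2 : g x / 2 < g x by lra.
have : \forall y \near x, g x / 2 < g y by exact: (cvgr_gt _ (cg x xab')).
move=> /nbhs_ballP[r /= r0 hr].
have [s s0 hs] := subitv xab r0.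
apply: (@Rintegral_gt0 _ _ _ mu `[a, b]%classic `]x - s, x + s[%classic g (g x / 2)).
- exact: measurable_itv.
- exact: measurable_itv.
- by move=> y /hs[].
- exact: subitv_gt0.
- apply: continuous_compact_integrable; first exact: segment_compact.
  by apply: continuous_in_subspaceT => y /set_mem; rewrite /= in_itv/=; exact: cg.
- by rewrite divr_gt0.
- by move=> y /=; rewrite in_itv/=; exact: g0.
- by move=> y /hs[_ /hr /ltW].
Qed.

Lemma Rintegral_rect_gt0 (a b c d : R) (U : set (R * R)) (g : R * R -> R)
    (p : R * R) :
  open U -> `[a, b]%classic `*` `[c, d]%classic `<=` U -> Ck 0 U g ->
  (forall q, (`[a, b]%classic `*` `[c, d]%classic) q -> 0 <= g q) ->
  a < p.1 < b -> c < p.2 < d -> 0 < g p ->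
  0 < Rintegral (mu \x mu)%E (`[a, b]%classic `*` `[c, d]%classic) g.
Proof.
move=> oU rectU cg g0 p1 p2 gp.
have ab : a < b by case/andP: p1; exact: lt_trans.
have cd : c < d by case/andP: p2; exact: lt_trans.
have Up : U p.
  apply: rectU; split; rewrite /= in_itv/=.
    by case/andP: p1 => /ltW-> /ltW->.
  by case/andP: p2 => /ltW-> /ltW->.
have gp2 : g p / 2 < g p by lra.
have : \forall q \near p, g p / 2 < g q by exact: (cvgr_gt _ (cg p Up)).
move=> /nbhs_ballP[r /= r0 hr].
have [s s0 hs] := subitv p1 r0.
have [t t0 ht] := subitv p2 r0.
have mI (u v : R) : measurable (`]u, v[%classic : set (measurableTypeR R)).
  exact: measurable_itv.
apply: (@Rintegral_gt0 _ _ _ (mu \x mu)%E _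
  (`]p.1 - s, p.1 + s[%classic `*` `]p.2 - t, p.2 + t[%classic) g (g p / 2)).
- exact: rect_measurable.
- exact: measurableX.
- by move=> q [/hs[? _] /ht[? _]].
- have E : (mu \x mu)%E (`]p.1 - s, p.1 + s[%classic `*` `]p.2 - t, p.2 + t[%classic) =
    (mu `](p.1 - s)%R, (p.1 + s)%R[%classic * mu `](p.2 - t)%R, (p.2 + t)%R[%classic)%E.
    by apply: product_measure1E; exact: measurable_itv.
  have pos : (0 < (mu \x mu) (`](p.1 - s)%R, (p.1 + s)%R[%classic `*`
      `](p.2 - t)%R, (p.2 + t)%R[%classic))%E.
    by rewrite E; apply: mule_gt0; exact: subitv_gt0.
  exact: pos.
- exact: (integrable_rect ab cd oU rectU cg).
- by rewrite divr_gt0.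
- exact: g0.
- by move=> q [/hs[_ q1] /ht[_ q2]]; apply/ltW/hr; split.
Qed.

End PositivityOnIntervals.

(** * Vector algebra in space *)

Section VectorAlgebra.
Context {R : realType}.
Implicit Types (u v w n : 'cV[R]_3) (t : R).

Lemma sum3 (F : 'I_3 -> R) : \sum_i F i = F 0 + F 1 + F 2.
Proof.
rewrite !big_ord_recl big_ord0 addr0 addrA.
by congr (F _ + F _ + F _); apply: val_inj.
Qed.

Lemma ord3_ind (P : 'I_3 -> Prop) : P 0 -> P 1 -> P 2 -> forall i, P i.
Proof.
move=> P0 P1 P2 [[|[|[|//]]] i3]; [move: P0|move: P1|move: P2];
  by congr P; apply: val_inj.
Qed.

Lemma vec3_inj u w :
  u 0 0 = w 0 0 -> u 1 0 = w 1 0 -> u 2 0 = w 2 0 -> u = w.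
Proof.
by move=> e0 e1 e2; apply/matrixP => i j; rewrite (ord1 j); elim/ord3_ind: i.
Qed.

Lemma vec3_0 (a b c : R) : vec3 a b c 0 0 = a. Proof. by rewrite mxE. Qed.
Lemma vec3_1 (a b c : R) : vec3 a b c 1 0 = b. Proof. by rewrite mxE. Qed.
Lemma vec3_2 (a b c : R) : vec3 a b c 2 0 = c. Proof. by rewrite mxE. Qed.

Definition vec3E := (vec3_0, vec3_1, vec3_2).

Lemma dotE u w : dot u w = u 0 0 * w 0 0 + u 1 0 * w 1 0 + u 2 0 * w 2 0.
Proof. by rewrite /dot sum3. Qed.

(** The determinant of three vectors; all densities below are of this form. *)
Definition triple u v w : R := dot u (cross v w).

Lemma tripleE u v w : triple u v w =
  u 0 0 * (v 1 0 * w 2 0 - v 2 0 * w 1 0) +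
  u 1 0 * (v 2 0 * w 0 0 - v 0 0 * w 2 0) +
  u 2 0 * (v 0 0 * w 1 0 - v 1 0 * w 0 0).
Proof. by rewrite /triple dotE !vec3E. Qed.

Lemma dotC u w : dot u w = dot w u.
Proof. by rewrite !dotE; ring. Qed.

Lemma dotDr u v w : dot u (v + w) = dot u v + dot u w.
Proof. by rewrite !dotE !mxE; ring. Qed.

Lemma dotZr t u w : dot u (t *: w) = t * dot u w.
Proof. by rewrite !dotE !mxE; ring. Qed.

Lemma dotDl u v w : dot (u + v) w = dot u w + dot v w.
Proof. by rewrite !dotE !mxE; ring. Qed.

Lemma dotZl t u w : dot (t *: u) w = t * dot u w.
Proof. by rewrite !dotE !mxE; ring. Qed.

Lemma dot0r u : dot u 0 = 0.
Proof. by rewrite !dotE !mxE; ring. Qed.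

Lemma dot0l u : dot 0 u = 0.
Proof. by rewrite dotC dot0r. Qed.

Lemma dot_ge0 u : 0 <= dot u u.
Proof. by rewrite dotE -!expr2 !addr_ge0// sqr_ge0. Qed.

Lemma dot_eq0 u : dot u u = 0 -> u = 0.
Proof.
rewrite dotE -!expr2 => h; have := sqr_ge0 (u 0 0).
have := sqr_ge0 (u 1 0); have := sqr_ge0 (u 2 0) => h2 h1 h0.
by apply: vec3_inj; rewrite !mxE; apply/eqP; rewrite -sqrf_eq0; apply/eqP; lra.
Qed.

Lemma enorm1 u : enorm u = 1 -> dot u u = 1.
Proof. by move=> h; rewrite -(sqr_sqrtr (dot_ge0 u)) -/(enorm u) h expr1n. Qed.

Lemma crossDl u v w : cross (u + v) w = cross u w + cross v w.
Proof. by apply: vec3_inj; rewrite !mxE /=; ring. Qed.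

Lemma crossZl t u w : cross (t *: u) w = t *: cross u w.
Proof. by apply: vec3_inj; rewrite !mxE /=; ring. Qed.

Lemma crossC u w : cross u w = - cross w u.
Proof. by apply: vec3_inj; rewrite !mxE /=; ring. Qed.

Lemma cross0r u : cross u 0 = 0.
Proof. by apply: vec3_inj; rewrite !mxE /=; ring. Qed.

Lemma crossvv u : cross u u = 0.
Proof. by apply: vec3_inj; rewrite !mxE /=; ring. Qed.

(** The expansion of the double vector product, from which the parallelism
    statements below follow without coordinates. *)
Lemma cross_cross u v w : cross u (cross v w) = dot u w *: v - dot u v *: w.
Proof. by apply: vec3_inj; rewrite !mxE /= !dotE; ring. Qed.

Lemma triple_rot u v w : triple u v w = triple v w u.
Proof. by rewrite !tripleE; ring. Qed.

Lemma triple_swap u v w : triple u v w = - triple u w v.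
Proof. by rewrite !tripleE; ring. Qed.

Lemma parallel_unit n u : dot n n = 1 -> cross n u = 0 -> u = dot n u *: n.
Proof.
move=> n1 nu; have := cross_cross n n u.
by rewrite nu cross0r n1 scale1r => /esym/subr0_eq.
Qed.

Lemma cross_orthogonal n u w : dot n n = 1 -> dot n u = 0 -> dot n w = 0 ->
  cross u w = triple n u w *: n.
Proof.
move=> n1 nu nw; apply: parallel_unit => //.
by rewrite cross_cross nu nw !scale0r subrr.
Qed.

Lemma dot_comb u v w (a b : R) : dot u (a *: v + b *: w) = a * dot u v + b * dot u w.
Proof. by rewrite dotDr !dotZr. Qed.

Lemma cross_free u w (a b : R) : cross u w != 0 -> a *: u + b *: w = 0 ->
  a = 0 /\ b = 0.
Proof.
move=> N0 E.
have c1 : a *: cross u w = 0.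
  have := congr1 (cross^~ w) E; rewrite /= crossDl !crossZl crossvv scaler0 addr0.
  by rewrite (crossC 0) cross0r oppr0.
have c2 : b *: cross u w = 0.
  have := congr1 (cross u) E.
  by rewrite cross0r (crossC u) crossDl !crossZl crossvv scaler0 add0r -scalerN -crossC.
by move: c1 c2 => /eqP + /eqP; rewrite !scaler_eq0 (negbTE N0) !orbF => /eqP-> /eqP->.
Qed.

Lemma cross_unit_eq0 n u : dot n n = 1 -> dot n u = 0 -> cross u n = 0 -> u = 0.
Proof.
move=> n1 nu c0; have := cross_cross n u n.
by rewrite c0 cross0r n1 nu scale1r scale0r subr0.
Qed.

End VectorAlgebra.

Section TripleCalculus.
Context {R : realType} {V : normedModType R}.

Lemma is_derive_coord (u : V -> 'cV[R]_3) p d i : derivable u p d ->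
  is_derive p d (fun q => u q i 0) ('D_d u p i 0).
Proof.
move=> du; split; first exact: ((derivable_mxP u p d).1 du i 0).
by rewrite derive_coord.
Qed.

Lemma derive_triple (u v w : V -> 'cV[R]_3) p d :
  derivable u p d -> derivable v p d -> derivable w p d ->
  'D_d (fun q => triple (u q) (v q) (w q)) p =
  triple ('D_d u p) (v p) (w p) + triple (u p) ('D_d v p) (w p) +
  triple (u p) (v p) ('D_d w p).
Proof.
move=> du dv dw.
have dM (f g : V -> R) (a b : R) : is_derive p d f a -> is_derive p d g b ->
  is_derive p d (fun q => f q * g q) (f p *: b + g p *: a).
  by move=> ? ?; exact: is_deriveM.
have dB (f g : V -> R) (a b : R) : is_derive p d f a -> is_derive p d g b ->
  is_derive p d (fun q => f q - g q) (a - b).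
  by move=> ? ?; exact: is_deriveB.
have dD (f g : V -> R) (a b : R) : is_derive p d f a -> is_derive p d g b ->
  is_derive p d (fun q => f q + g q) (a + b).
  by move=> ? ?; exact: is_deriveD.
have du' i := is_derive_coord i du; have dv' i := is_derive_coord i dv.
have dw' i := is_derive_coord i dw.
have dminor i j := dB _ _ _ _ (dM _ _ _ _ (dv' i) (dw' j)) (dM _ _ _ _ (dv' j) (dw' i)).
have [_] := dD _ _ _ _ (dD _ _ _ _ (dM _ _ _ _ (du' 0) (dminor 1 2))
  (dM _ _ _ _ (du' 1) (dminor 2 0))) (dM _ _ _ _ (du' 2) (dminor 0 1)).
under eq_fun do rewrite -tripleE.
move=> ->; rewrite !tripleE /GRing.scale/=.
move: ('D_d u p) ('D_d v p) ('D_d w p) => u' v' w'.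
by ring.
Qed.

Lemma derive_dot (u w : V -> 'cV[R]_3) p d : derivable u p d -> derivable w p d ->
  'D_d (fun q => dot (u q) (w q)) p = dot ('D_d u p) (w p) + dot (u p) ('D_d w p).
Proof.
move=> du dw.
have dM i : is_derive p d (fun q => u q i 0 * w q i 0)
    (u p i 0 *: 'D_d w p i 0 + w p i 0 *: 'D_d u p i 0).
  by apply: is_deriveM; exact: is_derive_coord.
have E : (fun q => dot (u q) (w q)) = (fun q => u q 0 0 * w q 0 0) +
    (fun q => u q 1 0 * w q 1 0) + (fun q => u q 2 0 * w q 2 0).
  by apply/funext => q; rewrite dotE.
have [_] := is_deriveD (is_deriveD (dM 0) (dM 1)) (dM 2).
rewrite -E.
move=> ->; rewrite !dotE /GRing.scale/=.
move: ('D_d u p) ('D_d w p) => u' w'.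
by ring.
Qed.

Lemma Ck_triple k (U : set V) (u v w : V -> 'cV[R]_3) : open U ->
  Ck k U u -> Ck k U v -> Ck k U w ->
  Ck k U (fun q => triple (u q) (v q) (w q)).
Proof.
move=> oU cu cv cw.
have cu' i := Ck_coord i 0 oU cu; have cv' i := Ck_coord i 0 oU cv.
have cw' i := Ck_coord i 0 oU cw.
under eq_fun do rewrite tripleE.
by do ![apply: Ck_sub => // | apply: Ck_add => // | apply: Ck_mul => //].
Qed.

Lemma Ck_dot k (U : set V) (u w : V -> 'cV[R]_3) : open U ->
  Ck k U u -> Ck k U w -> Ck k U (fun q => dot (u q) (w q)).
Proof.
move=> oU cu cw.
have cu' i := Ck_coord i 0 oU cu; have cw' i := Ck_coord i 0 oU cw.
under eq_fun do rewrite dotE.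
by do ![apply: Ck_add => // | apply: Ck_mul => //].
Qed.

Lemma Ck_vec3 k (U : set V) (a b c : V -> R) : open U ->
  Ck k U a -> Ck k U b -> Ck k U c -> Ck k U (fun q => vec3 (a q) (b q) (c q)).
Proof.
move=> oU ca cb cc.
apply: (Ck_eq (f := fun q => a q *: vec3 1 0 0 + b q *: vec3 0 1 0 + c q *: vec3 0 0 1)) => //.
  by move=> q _; apply: vec3_inj; rewrite ![in LHS]mxE !vec3E /=; ring.
by apply: (Ck_add oU); [apply: (Ck_add oU)|]; exact: (Ck_scalel _ oU).
Qed.

Lemma Ck_scale k (U : set V) (g : V -> R) (u : V -> 'cV[R]_3) : open U ->
  Ck k U g -> Ck k U u -> Ck k U (fun q => g q *: u q).
Proof.
move=> oU cg cu; have c i := Ck_mul oU cg (Ck_coord i 0 oU cu).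
apply: (Ck_eq (f := fun q => vec3 (g q * u q 0 0) (g q * u q 1 0) (g q * u q 2 0))) => //.
  by move=> q _; apply: vec3_inj; rewrite [RHS]mxE vec3E.
exact: (Ck_vec3 oU (c 0) (c 1) (c 2)).
Qed.

End TripleCalculus.

(** * The surface divergence in parameters *)

Section SurfaceDivergence.
Context {R : realType}.
Variables (f n u : R * R -> 'cV[R]_3) (p : R * R).

Let e1 : R * R * R := (1, 0, 0).
Let e2 : R * R * R := (0, 1, 0).
Let e3 : R * R * R := (0, 0, 1).

Let der_lift1 : 'D_e1 (fun q => u q.1) (p, 0) = 'D_((1, 0) : R * R) u p.
Proof. by []. Qed.

Let der_lift2 : 'D_e2 (fun q => u q.1) (p, 0) = 'D_((0, 1) : R * R) u p.
Proof. by []. Qed.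

Let stay (h : R) : (h *: e3 + (p, 0)).1 = p.
Proof. by rewrite /= (scaler0 _ h : h *: (0, 0) = 0) add0r. Qed.

Let der_lift3 : 'D_e3 (fun q => u q.1) (p, 0) = 0.
Proof.
have E : (fun h : R => h^-1 *: (u (h *: e3 + (p, 0)).1 - u p)) = cst 0.
  by apply/funext => h; rewrite stay subrr scaler0.
by rewrite -[LHS]/(lim ((fun h : R => h^-1 *: (u (h *: e3 + (p, 0)).1 - u p)) @ 0^'))
  E; apply: cvg_lim => //; exact: cvg_cst.
Qed.

Let der_chart (e : R * R * R) : e.2 = 0 ->
  'D_e (normal_chart f n) (p, 0) = 'D_(e.1) f p.
Proof.
move=> e0.
have E h : h^-1 *: (normal_chart f n (h *: e + (p, 0)) - normal_chart f n (p, 0)) =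
    h^-1 *: (f (h *: e.1 + p) - f p).
  by rewrite /normal_chart /= e0 (mulr0 h : h *: (0 : R) = 0) addr0 !scale0r !addr0.
by rewrite /derive; under eq_fun do rewrite E.
Qed.

Let der_chart3 : 'D_e3 (normal_chart f n) (p, 0) = n p.
Proof.
have stay0 (h : R) : h *: ((0, 0) : R * R) + p = p.
  by rewrite (scaler0 _ h : h *: ((0, 0) : R * R) = 0) add0r.
have E (h : R) : h != 0 ->
    h^-1 *: (normal_chart f n (h *: e3 + (p, 0)) - normal_chart f n (p, 0)) = n p.
  move=> h0.
  rewrite -[normal_chart f n (h *: e3 + _)]/(f (h *: ((0, 0) : R * R) + p) +
    (h *: 1 + 0) *: n (h *: ((0, 0) : R * R) + p)) stay0 addr0.
  rewrite /normal_chart /= scale0r addr0 (mulr1 h : h *: 1 = h).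
  by rewrite [f p + _]addrC addrK scalerA mulVf// scale1r.
apply/cvg_lim => //; apply: cvg_near_cst; near=> h; apply: E.
by near: h; exact: nbhs_dnbhs_neq.
Unshelve. all: by end_near. Qed.

(** In the frame [f_y, f_z, n] the dual basis consists of the vector
    products divided by the determinant, so the inverse Jacobian matrix of
    the normal chart is explicit. *)
Lemma surface_divE : triple (n p) (f_y f p) (f_z f p) != 0 ->
  surface_div f n u p =
  (triple ('D_((1, 0) : R * R) u p) (f_z f p) (n p) +
   triple ('D_((0, 1) : R * R) u p) (n p) (f_y f p)) /
  triple (n p) (f_y f p) (f_z f p).
Proof.
set J := triple _ _ _ => J0.
pose A := jac (fun q => u q.1) (p, 0); pose B := jac (normal_chart f n) (p, 0).
have A0 i : A i 0 = 'D_((1, 0) : R * R) u p i 0.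
  by rewrite mxE /= -/e1 der_lift1.
have A1 i : A i 1 = 'D_((0, 1) : R * R) u p i 0.
  by rewrite mxE /= -/e2 der_lift2.
have A2 i : A i 2 = 0 by rewrite mxE /= -/e3 der_lift3 mxE.
have B0 i : B i 0 = f_y f p i 0 by rewrite mxE /= -/e1 der_chart.
have B1 i : B i 1 = f_z f p i 0 by rewrite mxE /= -/e2 der_chart.
have B2 i : B i 2 = n p i 0 by rewrite mxE /= -/e3 der_chart3.
rewrite /surface_div /surface_grad -/A -/B.
move: A B A0 A1 A2 B0 B1 B2 => A B A0 A1 A2 B0 B1 B2.
pose C : 'M[R]_3 := \matrix_(i, j) ([:: cross (f_z f p) (n p); cross (n p) (f_y f p);
  cross (f_y f p) (f_z f p)]`_i j 0 / J).
have C0 j : C 0 j = cross (f_z f p) (n p) j 0 / J by rewrite mxE.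
have C1 j : C 1 j = cross (n p) (f_y f p) j 0 / J by rewrite mxE.
have C2 j : C 2 j = cross (f_y f p) (f_z f p) j 0 / J by rewrite mxE.
have JE : J = triple (n p) (f_y f p) (f_z f p) by [].
clearbody C; clearbody J.
have factor (x y z x' y' z' : R) :
  x / J * x' + y / J * y' + z / J * z' = (x * x' + y * y' + z * z') / J by ring.
have CB : C *m B = 1%:M.
  apply/matrixP => i j; rewrite !mxE sum3.
  move: (f_y f p) (f_z f p) (n p) C0 C1 C2 B0 B1 B2 JE => fy fz np C0 C1 C2 B0 B1 B2 JE.
  have diag X : X = J -> X / J = 1 by move=> ->; exact: divff.
  have off X : X = 0 -> X / J = 0 by move=> ->; exact: mul0r.
  elim/ord3_ind: i; elim/ord3_ind: j;
    rewrite ?(C0, C1, C2, B0, B1, B2) factor !vec3E.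
  - by apply: diag; rewrite JE tripleE; ring.
  - by apply: off; ring.
  - by apply: off; ring.
  - by apply: off; ring.
  - by apply: diag; rewrite JE tripleE; ring.
  - by apply: off; ring.
  - by apply: off; ring.
  - by apply: off; ring.
  - by apply: diag; rewrite JE tripleE; ring.
have [_ uB] := mulmx1_unit CB.
have -> : invmx B = C by rewrite -[LHS]mul1mx -CB -mulmxA mulmxV// mulmx1.
move: ('D_((1, 0) : R * R) u p) ('D_((0, 1) : R * R) u p) A0 A1 => uy uz A0 A1.
move: (f_y f p) (f_z f p) (n p) C0 C1 C2 {B0 B1 B2 CB uB B} JE => fy fz np C0 C1 C2 JE.
have E i : (A *m C) i i = A i 0 * C 0 i + A i 1 * C 1 i + A i 2 * C 2 i.
  by rewrite mxE sum3.
rewrite /mxtrace sum3 !E !A0 !A1 !A2 !C0 !C1 !vec3E !tripleE.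
by ring.
Qed.

End SurfaceDivergence.

(** * The reference rectangle *)

Section Segments.
Context {R : realType}.

Lemma sign_on_segment (k : R -> R) :
  (forall t, 0 <= t <= 1 -> {for t, continuous k}) ->
  (forall t, 0 <= t <= 1 -> k t != 0) -> 0 < k 0 -> 0 < k 1.
Proof.
move=> ck k0 k0p; rewrite ltNge; apply/negP => k1.
have ck' : {within `[0, 1], continuous k}.
  by apply: continuous_in_subspaceT => t /set_mem; rewrite /= in_itv/=; exact: ck.
have h : Num.min (k 0) (k 1) <= 0 <= Num.max (k 0) (k 1).
  by rewrite ge_min k1 orbT le_max ltW.
by have [t] := IVT ler01 ck' h; rewrite in_itv/= => /k0/eqP.
Qed.

Lemma line_continuous (p d : R * R) : continuous (fun t : R => t *: d + p).
Proof.
move=> t; apply: cvgD; last exact: cvg_cst.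
by apply: cvgZr_tmp; exact: cvg_id.
Qed.

(** Intermediate value theorem along the segment from [p] to [q]. *)
Lemma sign_between (g : R * R -> R) (p q : R * R) :
  (forall t, 0 <= t <= 1 -> {for t *: (q - p) + p, continuous g}) ->
  (forall t, 0 <= t <= 1 -> g (t *: (q - p) + p) != 0) -> 0 < g p -> 0 < g q.
Proof.
move=> cg g0 gp.
have := @sign_on_segment (fun t => g (t *: (q - p) + p)).
rewrite scale0r add0r scale1r subrK; apply => // t t01.
exact: (continuous_comp (@line_continuous p (q - p) t) (cg t t01)).
Qed.

End Segments.

Section ReferenceRectangle.
Context {R : realType} (rho : R) (rho0 : 0 < rho).

Lemma S0E : S0 rho = `[-1, 1]%classic `*` `[0, rho]%classic.
Proof.
by apply/seteqP; split=> p; rewrite /S0 /= !in_itv.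
Qed.

Lemma S0_convex (p q : R * R) (t : R) :
  0 <= t <= 1 -> S0 rho p -> S0 rho q -> S0 rho (t *: (q - p) + p).
Proof.
case: p q => [y z] [y' z'] /andP[t0 t1] [/= /andP[y1 y2] /andP[z1 z2]].
move=> [/= /andP[y1' y2'] /andP[z1' z2']].
rewrite /S0 /= /GRing.scale/=; split; apply/andP; split; nra.
Qed.

Definition intS0 : set (R * R) := [set p | -1 < p.1 < 1 /\ 0 < p.2 < rho].

Lemma intS0_sub : intS0 `<=` S0 rho.
Proof. by move=> p [/andP[/ltW a /ltW b] /andP[/ltW c /ltW d]]; split; apply/andP. Qed.

Lemma nbhs_intS0 p : intS0 p -> \forall q \near p, intS0 q.
Proof.
move=> [/andP[a b] /andP[c d]].
have c1 : (fun q : R * R => q.1) @ p --> p.1 by exact: cvg_fst.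
have c2 : (fun q : R * R => q.2) @ p --> p.2 by exact: cvg_snd.
near=> q; split; apply/andP; split; near: q.
- exact: (cvgr_gt _ c1).
- exact: (cvgr_lt _ c1).
- exact: (cvgr_gt _ c2).
- exact: (cvgr_lt _ c2).
Unshelve. all: by end_near. Qed.

(** The rectangle is star-shaped about its centre. *)
Lemma intS0_dense p : S0 rho p ->
  \forall t \near (0 : R)^'+, intS0 (t *: ((0, rho / 2) - p) + p).
Proof.
case: p => y z [/= /andP[y1 y2] /andP[z1 z2]]; near=> t.
have t0 : 0 < t by near: t; exact: nbhs_right_gt.
have t1 : t < 1 by near: t; exact: nbhs_right_lt.
have a1 : 0 <= (1 - t) * (1 - y) by apply: mulr_ge0; lra.
have a2 : 0 <= (1 - t) * (1 + y) by apply: mulr_ge0; lra.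
have a3 : 0 <= (1 - t) * z by apply: mulr_ge0; lra.
have a4 : 0 <= (1 - t) * (rho - z) by apply: mulr_ge0; lra.
have a5 : 0 < t * rho by exact: mulr_gt0.
rewrite /intS0 /= /GRing.scale/=; split; apply/andP; split; lra.
Unshelve. all: by end_near. Qed.

(** Identities that come from differentiating a relation valid on the closed
    rectangle hold in the interior; continuity carries them to the boundary. *)
Lemma eq0_on_S0 (g : R * R -> R) : (forall p, S0 rho p -> {for p, continuous g}) ->
  (forall p, intS0 p -> g p = 0) -> forall p, S0 rho p -> g p = 0.
Proof.
move=> cg g0 p Sp.
have cl : (fun t : R => g (t *: ((0, rho / 2) - p) + p)) @ 0^'+ --> g p.
  apply: cvg_at_right_filter.
  have cg0 : {for (0 : R) *: ((0, rho / 2) - p) + p, continuous g}.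
    by rewrite scale0r add0r; exact: cg.
  have := continuous_comp (@line_continuous R p ((0, rho / 2) - p) 0) cg0.
  by rewrite /prop_for /continuous_at /= scale0r add0r.
have c0 : (fun t : R => g (t *: ((0, rho / 2) - p) + p)) @ 0^'+ --> (0 : R).
  apply: cvg_near_cst.
  by apply: filterS (intS0_dense Sp) => t; exact: g0.
exact: (cvg_unique _ cl c0).
Qed.

End ReferenceRectangle.

(** * The first variation as a planar divergence *)

(** A regular parametrized surface with its unit normal, where [f] and [n]
    are smooth on the same neighbourhood [U] of the rectangle. *)
Record oriented_surface (R : realType) (rho : R) (f n : R * R -> 'cV[R]_3)
    (U : set (R * R)) : Prop := OrientedSurface {
  surf_rho : 0 < rho;
  surf_open : open U;
  surf_sub : S0 rho `<=` U;
  surf_C2 : Ck 2 U f;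
  surf_normal_C1 : Ck 1 U n;
  surf_regular : forall p, S0 rho p -> cross (f_y f p) (f_z f p) != 0;
  surf_normal : forall p, S0 rho p ->
    [/\ dot (n p) (n p) = 1, dot (n p) (f_y f p) = 0 & dot (n p) (f_z f p) = 0] }.

Section Surface.
Local Opaque Ck derive.
Context {R : realType}.
Variables (rho : R) (f n : R * R -> 'cV[R]_3) (U : set (R * R)).
Hypothesis surf : oriented_surface rho f n U.

Let rho0 := surf_rho surf.
Let oU := surf_open surf.
Let S0U := surf_sub surf.
Let cf := surf_C2 surf.
Let cn := surf_normal_C1 surf.
Let regular := surf_regular surf.
Let normal := surf_normal surf.

Local Notation ey := ((1, 0) : R * R).
Local Notation ez := ((0, 1) : R * R).
Let mu : {sigma_finite_measure set (measurableTypeR R) -> \bar R} := @lebesgue_measure R.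

(** The signed area element: its absolute value is the length of [cross (f_y
    f p) (f_z f p)]. *)
Definition jacobian3 p := triple (n p) (f_y f p) (f_z f p).

Lemma cross_tangents p : S0 rho p -> cross (f_y f p) (f_z f p) = jacobian3 p *: n p.
Proof. by move=> /normal[n1 ny nz]; exact: cross_orthogonal. Qed.

Lemma jacobian3_neq0 p : S0 rho p -> jacobian3 p != 0.
Proof.
move=> Sp; apply: contra_neq (regular Sp) => J0.
by rewrite cross_tangents// J0 scale0r.
Qed.

Lemma area_element p : S0 rho p ->
  enorm (cross (f_y f p) (f_z f p)) = `|jacobian3 p|.
Proof.
move=> Sp; have [n1 _ _] := normal Sp; rewrite cross_tangents// /enorm.
by rewrite dotZl dotZr n1 mulr1 -expr2 sqrtr_sqr.
Qed.

Lemma f_y_C1 : Ck 1 U (f_y f). Proof. exact: (CkD ey cf). Qed.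
Lemma f_z_C1 : Ck 1 U (f_z f). Proof. exact: (CkD ez cf). Qed.

Lemma jacobian3_C1 : Ck 1 U jacobian3.
Proof. exact: (Ck_triple oU cn f_y_C1 f_z_C1). Qed.

(** The signed area element does not vanish on the rectangle, which is
    convex, so it has a constant sign. *)
Lemma orientation : exists2 eps : R, eps ^+ 2 = 1 &
  forall p, S0 rho p -> `|jacobian3 p| = eps * jacobian3 p.
Proof.
pose o : R * R := (0, 0).
have So : S0 rho o.
  by split; apply/andP; split; rewrite /= ?lexx ?ler01 ?lerN10 ?ltW.
pose eps := Num.sg (jacobian3 o).
have e2 : eps ^+ 2 = 1 by rewrite sqr_sg jacobian3_neq0.
exists eps => // p Sp.
suff : 0 < eps * jacobian3 p.
  move=> h; rewrite -[RHS]ger0_norm ?ltW// normrM.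
  by rewrite /eps normr_sg jacobian3_neq0// mul1r.
apply: (@sign_between R (fun q => eps * jacobian3 q) o p) => [t t01|t t01|].
- have /S0U Ut := S0_convex t01 So Sp.
  by apply: cvgMl_tmp; exact: (Ck_continuous jacobian3_C1 Ut).
- have St := S0_convex t01 So Sp.
  by rewrite mulf_neq0 ?jacobian3_neq0// -sqrf_eq0 e2 oner_eq0.
- by rewrite /eps -normrEsg normr_gt0 jacobian3_neq0.
Qed.

(** Differentiate [dot n n = 1] in the interior. *)
Lemma normal_derive d p : S0 rho p -> dot (n p) ('D_d n p) = 0.
Proof.
move: p; apply: (eq0_on_S0 rho0) => p Sp.
  have h : Ck 0 U (fun p => dot (n p) ('D_d n p)).
    exact: (Ck_dot oU (CkW cn) (CkD d cn)).
  exact: (Ck_continuous h (S0U Sp)).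
have Up := S0U (intS0_sub Sp).
have dn : derivable n p d.
  by apply: diff_derivable; exact: (Ck_differentiable cn Up).
have := derive_dot dn dn; rewrite (@near_eq_derive _ _ _ _ (fun=> 1 : R)); last first.
  by near=> q; have [|->//] := @normal q; apply: intS0_sub; near: q; exact: nbhs_intS0.
rewrite derive_cst (dotC _ (n p)).
by move: (dot _ _) => x; lra.
Unshelve. all: by end_near. Qed.

Lemma mixed_derivatives p : U p -> 'D_ey (f_z f) p = 'D_ez (f_y f) p.
Proof.
move=> Up.
have mixed_coord d e i : 'D_d ('D_e f) p i 0 = 'D_d ('D_e (fun q => f q i 0)) p.
  rewrite -derive_coord; last first.
    by apply: diff_derivable; exact: (Ck_differentiable (CkD e cf) Up).
  apply: near_eq_derive; have := open_nbhs_nbhs (conj oU Up).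
  apply: filterS => q Uq; rewrite derive_coord//.
  by apply: diff_derivable; exact: (Ck_differentiable cf Uq).
apply/matrixP => i j; rewrite (ord1 j).
have comm := derive_comm oU (Ck_coord i 0 oU cf) Up ez ey.
exact: (etrans (mixed_coord ey ez i) (etrans comm (esym (mixed_coord ez ey i)))).
Qed.

(** Twice the mean curvature times the signed area element; unlike the mean
    curvature it has no denominator. *)
Definition normal_bending p :=
  triple (n p) (f_z f p) ('D_ey n p) + triple (n p) ('D_ez n p) (f_y f p).

Lemma normal_bending_C0 : Ck 0 U normal_bending.
Proof.
apply: (Ck_add oU).
  exact: (Ck_triple oU (CkW cn) (CkW f_z_C1) (CkD ey cn)).
exact: (Ck_triple oU (CkW cn) (CkD ez cn) (CkW f_y_C1)).
Qed.

Lemma mean_curvatureE p : S0 rho p ->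
  mean_curvature f n p = normal_bending p / (2 * jacobian3 p).
Proof.
move=> Sp; have J0 := jacobian3_neq0 Sp.
rewrite /mean_curvature /curvature_tensor raddfN /= -/(surface_div f n n p).
rewrite surface_divE// -/(jacobian3 p) /normal_bending.
move: (jacobian3 p) J0 => J J0.
move: ('D_ey n p) ('D_ez n p) => ny nz.
have -> : triple ny (f_z f p) (n p) = - triple (n p) (f_z f p) ny.
  by rewrite triple_rot triple_rot triple_swap.
have -> : triple nz (n p) (f_y f p) = - triple (n p) nz (f_y f p).
  by rewrite triple_rot triple_swap.
by field.
Qed.

Section Variation.
Variables (v : R * R -> 'cV[R]_3) (Uv : set (R * R)).
Hypotheses (oUv : open Uv) (S0Uv : S0 rho `<=` Uv) (cv : Ck 2 Uv v).

Let W := U `&` Uv.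
Let oW : open W. Proof. exact: openI. Qed.
Let S0W : S0 rho `<=` W. Proof. by move=> p Sp; split; [exact: S0U|exact: S0Uv]. Qed.
Let WU : W `<=` U. Proof. by move=> p []. Qed.
Let cvW : Ck 2 W v. Proof. by apply: Ck_subset cv => p []. Qed.

(** [flux_y] and [flux_z] are the contravariant components of the velocity
    times the signed area element, so that the planar divergence of this
    pair is that element times the surface divergence of the tangential part
    of the velocity. *)
Definition flux_y p := triple (v p) (f_z f p) (n p).
Definition flux_z p := triple (v p) (n p) (f_y f p).

Lemma flux_y_C1 : Ck 1 W flux_y.
Proof.
exact: (Ck_triple oW (CkW cvW) (Ck_subset WU f_z_C1) (Ck_subset WU cn)).
Qed.

Lemma flux_z_C1 : Ck 1 W flux_z.
Proof.
exact: (Ck_triple oW (CkW cvW) (Ck_subset WU cn) (Ck_subset WU f_y_C1)).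
Qed.

Lemma bending_work_C0 : Ck 0 W (fun p => dot (v p) (n p) * normal_bending p).
Proof.
have cnW := Ck_subset WU cn.
apply: (Ck_mul oW); first exact: (Ck_dot oW (CkW (CkW cvW)) (CkW cnW)).
exact: (Ck_subset WU normal_bending_C0).
Qed.

(** By the product rule the planar divergence has the two terms with
    derivatives of [v], which are the surface divergence; two terms with the
    mixed second derivative of [f], which cancel by symmetry; and two terms
    with derivatives of [n]. The latter pair [v] with vectors that are
    products of tangent vectors, hence multiples of [n]. *)
Lemma surface_div_flux p : S0 rho p ->
  surface_div f n v p * jacobian3 p =
  'D_ey flux_y p + 'D_ez flux_z p - dot (v p) (n p) * normal_bending p.
Proof.
move=> Sp; have [Up Uvp] := S0W Sp; have J0 := jacobian3_neq0 Sp.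
have dv d : derivable v p d.
  by apply: diff_derivable; exact: (Ck_differentiable cv Uvp).
have dn d : derivable n p d.
  by apply: diff_derivable; exact: (Ck_differentiable cn Up).
have dfy d : derivable (f_y f) p d.
  by apply: diff_derivable; exact: (Ck_differentiable f_y_C1 Up).
have dfz d : derivable (f_z f) p d.
  by apply: diff_derivable; exact: (Ck_differentiable f_z_C1 Up).
rewrite surface_divE// -/(jacobian3 p) divfK//.
rewrite (derive_triple (dv ey) (dfz ey) (dn ey)).
rewrite (derive_triple (dv ez) (dn ez) (dfy ez)) mixed_derivatives//.
have ny := normal_derive ey Sp; have nz := normal_derive ez Sp.
have [n1 nfy nfz] := normal Sp.
rewrite /normal_bending.
move: ('D_ey n p) ('D_ez n p) ('D_ez (f_y f) p) ny nz => ny nz fyz ny0 nz0.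
have -> : triple (v p) (f_z f p) ny = triple (n p) (f_z f p) ny * dot (v p) (n p).
  by rewrite {1}/triple (cross_orthogonal n1 nfz ny0) dotZr.
have -> : triple (v p) nz (f_y f p) = triple (n p) nz (f_y f p) * dot (v p) (n p).
  by rewrite {1}/triple (cross_orthogonal n1 nz0 nfy) dotZr.
rewrite (triple_swap (v p) fyz (n p)).
by move: ('D_ey v p) ('D_ez v p) => vy vz; ring.
Qed.

(** The first variation formula: minus the mean curvature term plus the
    boundary term, both pulled back to the rectangle. *)
Lemma first_variationE (sigma eps : R) :
  (forall p, S0 rho p -> `|jacobian3 p| = eps * jacobian3 p) ->
  first_variation rho f n sigma v = sigma * eps *
   (Rintegral mu `[0, rho] (fun z => flux_y (1, z) - flux_y (-1, z)) +
    Rintegral mu `[-1, 1] (fun y => flux_z (y, rho) - flux_z (y, 0)) -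
    Rintegral (mu \x mu)%E (S0 rho)
      (fun p => dot (v p) (n p) * normal_bending p)).
Proof.
move=> epsE; rewrite /first_variation /surface_integral.
have N11 : -1 < 1 :> R by lra.
have rectW : `[-1, 1]%classic `*` `[0, rho]%classic `<=` W by rewrite -S0E.
have iB := integrable_rect N11 rho0 oW rectW bending_work_C0.
have iy := integrable_rect N11 rho0 oW rectW (CkD ey flux_y_C1).
have iz := integrable_rect N11 rho0 oW rectW (CkD ez flux_z_C1).
have mS : measurable (`[-1, 1]%classic `*` `[0, rho]%classic :
  set (measurableTypeR R * measurableTypeR R)) by exact: rect_measurable.
have iD := integrableD mS iy iz.
rewrite -(divergence_rect N11 rho0 oW rectW flux_y_C1 flux_z_C1) S0E.
rewrite -(RintegralB mS iD iB) -(RintegralZl _ mS (integrableB mS iD iB)).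
apply: eq_Rintegral => p /set_mem; rewrite -S0E => Sp.
rewrite area_element// epsE// -(surface_div_flux Sp).
by move: (surface_div _ _ _ _) (jacobian3 p) => x y; ring.
Qed.

End Variation.

End Surface.

(** * Bump functions and limits at the ends of an interval *)

Section BumpFunction.
Context {R : realType}.

(** The cube of the positive part of [r ^+ 2 - |p - p0| ^+ 2], which is of
    class C^2 and is supported in the disc of radius [r] about [p0]. *)
Lemma bump_function (p0 : R * R) (N : set (R * R)) : nbhs p0 N ->
  exists phi : R * R -> R, [/\ Ck 2 setT phi, forall p, 0 <= phi p, 0 < phi p0 &
    forall p, ~ N p -> phi p = 0].
Proof.
move=> /nbhs_ballP[r /= r0 hr].
pose psi (p : R * R) := r ^+ 2 - ((p.1 - p0.1) ^+ 2 + (p.2 - p0.2) ^+ 2).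
have oT : open [set: R * R] by exact: openT.
have c1 : Ck 2 [set: R * R] (fun p : R * R => p.1 - p0.1).
  have cf : continuous (fst : {linear (R * R)%type -> R}) by move=> p; exact: cvg_fst.
  exact: (Ck_sub oT (@Ck_linear _ _ _ 2 setT _ cf) (Ck_cst _ _ _)).
have c2 : Ck 2 [set: R * R] (fun p : R * R => p.2 - p0.2).
  have cs : continuous (snd : {linear (R * R)%type -> R}) by move=> p; exact: cvg_snd.
  exact: (Ck_sub oT (@Ck_linear _ _ _ 2 setT _ cs) (Ck_cst _ _ _)).
have cpsi : Ck 2 [set: R * R] psi.
  apply: (Ck_sub oT (Ck_cst _ _ _)).
  exact: (Ck_add oT (Ck_mul oT c1 c1) (Ck_mul oT c2 c2)).
exists (fun p => Num.max 0 (psi p) ^+ 3); split.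
- exact: (Ck_posX oT cpsi).
- by move=> p; rewrite exprn_ge0// le_max lexx.
- rewrite exprn_gt0// lt_max; apply/orP; right.
  by rewrite /psi !subrr !expr0n/= addr0 subr0 exprn_gt0.
move=> p Np; rewrite (_ : Num.max _ _ = 0) ?expr0n//; apply/max_idPl.
rewrite leNgt; apply/negP; rewrite /psi subr_gt0 => h; apply: Np; apply: hr.
have h1 := sqr_ge0 (p.1 - p0.1); have h2 := sqr_ge0 (p.2 - p0.2).
by split; rewrite /ball /= distrC ltr_norml; apply/andP; split; nra.
Qed.

End BumpFunction.

Section IntervalClosure.
Context {R : realType}.

Lemma ge0_on_closure (a b : R) (k : R -> R) : a < b ->
  (forall y, a <= y <= b -> {for y, continuous k}) ->
  (forall y, a < y < b -> 0 <= k y) -> forall y, a <= y <= b -> 0 <= k y.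
Proof.
move=> ab ck k0 y yab; rewrite leNgt; apply/negP => ky.
have : \forall x \near y, k x < 0 by exact: (cvgr_lt _ (ck y yab)).
move=> /nbhs_ballP[r /= r0 hr].
(* Move from [y] towards the midpoint by less than [r]. *)
pose s := Num.min 1 (r / (b - a)).
have s0 : 0 < s by rewrite /s lt_min ltr01 divr_gt0 ?subr_gt0.
have [s1 sr] : s <= 1 /\ s * (b - a) <= r.
  rewrite /s ge_min lexx; split=> //; rewrite -ler_pdivlMr ?subr_gt0//.
  by rewrite ge_min lexx orbT.
have /andP[ya yb] := yab.
pose x := y + s * ((a + b) / 2 - y).
have xab : a < x < b.
  by rewrite /x; apply/andP; split; nra.
have : k x < 0.
  apply: hr; rewrite /ball /= /x opprD addNKr normrN normrM gtr0_norm//.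
  have [d1 d2] : (a + b) / 2 - y < b - a /\ - (b - a) < (a + b) / 2 - y by lra.
  have : `|(a + b) / 2 - y| < b - a by rewrite ltr_norml d1 d2.
  by move=> d; apply: lt_le_trans sr; rewrite ltr_pM2l.
by rewrite ltNge k0.
Qed.

Lemma eq0_on_closure (a b : R) (k : R -> R) : a < b ->
  (forall y, a <= y <= b -> {for y, continuous k}) ->
  (forall y, a < y < b -> k y = 0) -> forall y, a <= y <= b -> k y = 0.
Proof.
move=> ab ck k0 y yab; apply/eqP; rewrite eq_le; apply/andP; split.
  rewrite -oppr_ge0; apply: (ge0_on_closure (k := fun y => - k y) ab) yab.
    by move=> z /ck; exact: cvgN.
  by move=> z /k0 ->; rewrite oppr0.
by apply: (ge0_on_closure ab ck) yab => z /k0 ->.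
Qed.

End IntervalClosure.

(** * The flux through the boundary *)

Section BoundaryFlux.
Local Opaque Ck derive flux_y flux_z.
Context {R : realType} (rho : R).
Variables (f n : R * R -> 'cV[R]_3) (U : set (R * R)).
Hypothesis surf : oriented_surface rho f n U.
Variables (v : R * R -> 'cV[R]_3) (Uv : set (R * R)).
Hypotheses (oUv : open Uv) (S0Uv : S0 rho `<=` Uv) (cv : Ck 2 Uv v).

Let mu : {sigma_finite_measure set (measurableTypeR R) -> \bar R} := @lebesgue_measure R.
Let rho0 := surf_rho surf.

Lemma edge_lateral (y z : R) : `|y| = 1 -> 0 < z < rho ->
  edges rho (y, z) /\ outer_normal (y, z) = (y, 0).
Proof.
by move=> y1 zr; split; [left|rewrite /outer_normal /= y1 ltxx].
Qed.

Lemma edge_horizontal (y z : R) : `|y| < 1 -> z = 0 \/ z = rho ->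
  edges rho (y, z) /\ outer_normal (y, z) = (0, if z == 0 then -1 else 1).
Proof.
by move=> y1 zr; split; [right|rewrite /outer_normal /= y1].
Qed.

(** Through any edge the flux is taken in the direction of the outer normal
    of the rectangle; this treats the four edges alike. *)
Definition edge_flux p := (outer_normal p).1 * flux_y f n v p +
  (outer_normal p).2 * flux_z f n v p.

Definition total_flux : R :=
  Rintegral mu `[0, rho] (fun z => flux_y f n v (1, z) - flux_y f n v (-1, z)) +
  Rintegral mu `[-1, 1] (fun y => flux_z f n v (y, rho) - flux_z f n v (y, 0)).

Let S0W : S0 rho `<=` U `&` Uv.
Proof. by move=> p Sp; split; [exact: (surf_sub surf)|exact: S0Uv]. Qed.

Let lateral_continuous z : 0 <= z <= rho ->
  {for z, continuous (fun z => flux_y f n v (1, z) - flux_y f n v (-1, z))}.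
Proof.
move=> zr.
have c y : -1 <= y <= 1 -> {for z, continuous (fun z => flux_y f n v (y, z))}.
  move=> yI; have Wyz : (U `&` Uv) (y, z) by apply: S0W.
  have cz : {for z, continuous (fun z => (y, z))} by exact: (cvg_pair (cvg_cst y) cvg_id).
  exact: (continuous_comp cz (Ck_continuous (flux_y_C1 surf oUv cv) Wyz)).
by apply: cvgB; apply: c; rewrite lexx ?andbT; lra.
Qed.

Let horizontal_continuous y : -1 <= y <= 1 ->
  {for y, continuous (fun y => flux_z f n v (y, rho) - flux_z f n v (y, 0))}.
Proof.
move=> yI.
have c z : 0 <= z <= rho -> {for y, continuous (fun y => flux_z f n v (y, z))}.
  move=> zI; have Wyz : (U `&` Uv) (y, z) by apply: S0W.
  have cy : {for y, continuous (fun y => (y, z))} by exact: (cvg_pair cvg_id (cvg_cst z)).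
  exact: (continuous_comp cy (Ck_continuous (flux_z_C1 surf oUv cv) Wyz)).
by apply: cvgB; apply: c; rewrite lexx ?andbT ltW.
Qed.

Let lateral_flux z : 0 < z < rho ->
  flux_y f n v (1, z) - flux_y f n v (-1, z) = edge_flux (1, z) + edge_flux (-1, z).
Proof.
move=> zr; rewrite /edge_flux.
rewrite (edge_lateral (normr1 R) zr).2 (edge_lateral (normrN1 R) zr).2 /=.
move: (flux_y _ _ _ (1, z)) (flux_y _ _ _ (-1, z)) => a b.
by move: (flux_z _ _ _ (1, z)) (flux_z _ _ _ (-1, z)) => c d; ring.
Qed.

Let horizontal_flux y : -1 < y < 1 ->
  flux_z f n v (y, rho) - flux_z f n v (y, 0) = edge_flux (y, rho) + edge_flux (y, 0).
Proof.
move=> /andP[y1 y2]; have y3 : `|y| < 1 by rewrite ltr_norml y1.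
rewrite /edge_flux (edge_horizontal y3 (or_introl erefl)).2.
rewrite (edge_horizontal y3 (or_intror erefl)).2 /= eqxx (gt_eqF rho0).
move: (flux_y _ _ _ (y, rho)) (flux_y _ _ _ (y, 0)) => a b.
by move: (flux_z _ _ _ (y, rho)) (flux_z _ _ _ (y, 0)) => c d; ring.
Qed.

Let N11 : -1 < 1 :> R. Proof. by lra. Qed.

Let lateral_edges z : 0 < z < rho -> edges rho (1, z) /\ edges rho (-1, z).
Proof.
by move=> zr; split; [exact: (edge_lateral (normr1 R) zr).1|
  exact: (edge_lateral (normrN1 R) zr).1].
Qed.

Let horizontal_edges y : -1 < y < 1 -> edges rho (y, rho) /\ edges rho (y, 0).
Proof.
move=> /andP[y1 y2]; have y3 : `|y| < 1 by rewrite ltr_norml y1.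
by split; [exact: (edge_horizontal y3 (or_intror erefl)).1|
  exact: (edge_horizontal y3 (or_introl erefl)).1].
Qed.

Local Opaque edge_flux.

Lemma total_flux_eq0 : (forall p, edges rho p -> edge_flux p = 0) -> total_flux = 0.
Proof.
move=> e0; rewrite /total_flux.
have h1 z : 0 <= z <= rho -> flux_y f n v (1, z) - flux_y f n v (-1, z) = 0.
  apply: (eq0_on_closure rho0 lateral_continuous) => {}z zr.
  by have [? ?] := lateral_edges zr; rewrite lateral_flux// !e0 ?addr0.
have h2 y : -1 <= y <= 1 -> flux_z f n v (y, rho) - flux_z f n v (y, 0) = 0.
  apply: (eq0_on_closure N11 horizontal_continuous) => {}y yI.
  by have [? ?] := horizontal_edges yI; rewrite horizontal_flux// !e0 ?addr0.
have zero a b (k : R -> R) : (forall x, a <= x <= b -> k x = 0) ->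
    Rintegral mu `[a, b] k = 0.
  move=> k0; transitivity (Rintegral mu `[a, b] (fun=> 0)).
    by apply: eq_Rintegral => x /set_mem; rewrite /= in_itv/=; exact: k0.
  by rewrite Rintegral_cst ?mul0r//; exact: measurable_itv.
by rewrite !zero ?addr0.
Qed.

(** No cancellation is possible between nonnegative fluxes, so one positive
    value makes the sum of the four boundary integrals positive. *)
Lemma total_flux_gt0 p0 : (forall p, edges rho p -> 0 <= edge_flux p) ->
  edges rho p0 -> 0 < edge_flux p0 -> 0 < total_flux.
Proof.
move=> e0 ep0 fp0; rewrite /total_flux.
have h1 z : 0 <= z <= rho -> 0 <= flux_y f n v (1, z) - flux_y f n v (-1, z).
  apply: (ge0_on_closure rho0 lateral_continuous) => {}z zr.
  by have [? ?] := lateral_edges zr; rewrite lateral_flux//; apply: addr_ge0; exact: e0.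
have h2 y : -1 <= y <= 1 -> 0 <= flux_z f n v (y, rho) - flux_z f n v (y, 0).
  apply: (ge0_on_closure N11 horizontal_continuous) => {}y yI.
  by have [? ?] := horizontal_edges yI; rewrite horizontal_flux//; apply: addr_ge0; exact: e0.
have i1 : 0 <= Rintegral mu `[0, rho] (fun z => flux_y f n v (1, z) - flux_y f n v (-1, z)).
  by apply: Rintegral_ge0 => z; rewrite /= in_itv/=; exact: h1.
have i2 : 0 <= Rintegral mu `[-1, 1] (fun y => flux_z f n v (y, rho) - flux_z f n v (y, 0)).
  by apply: Rintegral_ge0 => z; rewrite /= in_itv/=; exact: h2.
case: p0 ep0 fp0 => y z [[/= y1 zr]|[/= y1 zr]] fp0.
  apply: (ltr_pwDl _ i2); apply: (Rintegral_itv_gt0 lateral_continuous h1 zr).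
  rewrite lateral_flux//; have [/e0 er /e0 el] := lateral_edges zr.
  have [yE|yE] : y = 1 \/ y = -1.
    by move/eqP: y1; rewrite eqr_norml ler01 andbT => /orP[] /eqP; [left|right].
    by rewrite yE in fp0; exact: (ltr_pwDl fp0 el).
  by rewrite yE in fp0; exact: (ltr_wpDl er fp0).
apply: (ltr_wpDl i1).
have yI : -1 < y < 1 by rewrite -ltr_norml.
apply: (Rintegral_itv_gt0 horizontal_continuous h2 yI).
rewrite horizontal_flux//; have [/e0 et /e0 eb] := horizontal_edges yI.
by case: zr => zE; rewrite zE in fp0; [exact: (ltr_wpDl et fp0)|exact: (ltr_pwDl fp0 eb)].
Qed.

End BoundaryFlux.

(** * The conormal along the edges *)

(** In the orthonormal frame [m], [(- m2, m1)] the component of a linear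
    form along [(- m2, m1)] vanishes, so its value at [d] only sees the
    component of [d] along [m]. *)
Lemma rotated_frame (R : realType) (m1 m2 d1 d2 a b : R) :
  m1 ^+ 2 + m2 ^+ 2 = 1 -> - m2 * a + m1 * b = 0 -> d1 * a + d2 * b = 1 ->
  (d1 * m1 + d2 * m2) * (m1 * a + m2 * b) = 1.
Proof.
move=> m11 t0 ab; have mab : m1 * b = m2 * a by lra.
transitivity ((d1 * a + d2 * b) * (m1 ^+ 2 + m2 ^+ 2)); last by rewrite ab m11 mulr1.
have e1 : d1 * m1 * (m2 * b) = d1 * m2 * (m2 * a) by rewrite -mab; ring.
have e2 : d2 * m2 * (m1 * a) = d2 * m1 * (m1 * b) by rewrite mab; ring.
transitivity (d1 * m1 * (m1 * a) + d1 * m1 * (m2 * b) +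
  d2 * m2 * (m1 * a) + d2 * m2 * (m2 * b)); first by ring.
by rewrite e1 e2; ring.
Qed.

Section EdgeGeometry.
Local Opaque Ck derive.
Context {R : realType} (rho : R).
Variables (f n : R * R -> 'cV[R]_3) (U : set (R * R)).
Hypothesis surf : oriented_surface rho f n U.

Lemma derive_plane (d p : R * R) : U p ->
  'D_d f p = d.1 *: f_y f p + d.2 *: f_z f p.
Proof.
move=> Up; have df := Ck_differentiable (surf_C2 surf) Up.
have dE : d = d.1 *: ((1, 0) : R * R) + d.2 *: ((0, 1) : R * R).
  case: d => a b; congr pair; rewrite /=.
    by rewrite (mulr1 a : a *: 1 = a) (mulr0 b : b *: 0 = 0) addr0.
  by rewrite (mulr1 b : b *: 1 = b) (mulr0 a : a *: 0 = 0) add0r.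
by rewrite {1}dE /f_y /f_z !deriveE// linearD !linearZ.
Qed.

Local Opaque f_y f_z.

Lemma tangent_neq0 (d p : R * R) : S0 rho p -> d != 0 -> 'D_d f p != 0.
Proof.
move=> Sp; apply: contra_neq; rewrite (derive_plane _ (surf_sub surf Sp)) => d0.
have [a0 b0] := cross_free (surf_regular surf Sp) d0.
by rewrite [d]surjective_pairing a0 b0.
Qed.

Lemma dot_derive u (d p : R * R) : U p ->
  dot u ('D_d f p) = d.1 * dot u (f_y f p) + d.2 * dot u (f_z f p).
Proof.
by move=> Up; exact: (etrans (congr1 (dot u) (derive_plane d Up)) (dot_comb _ _ _ _ _)).
Qed.

Lemma normal_tangent (d p : R * R) : S0 rho p -> dot (n p) ('D_d f p) = 0.
Proof.
move=> Sp; have [_ ny nz] := surf_normal surf Sp.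
by rewrite (dot_derive _ _ (surf_sub surf Sp)) ny nz !mulr0 addr0.
Qed.

Lemma edges_bdS0 p : edges rho p -> bdS0 rho p.
Proof.
have rho0 := surf_rho surf.
case: p => y z [[/= y1 /andP[z1 z2]]|[/= y1 z0]].
  have yy : -1 <= y <= 1 by rewrite -ler_norml y1.
  split; first by split=> //=; rewrite !ltW.
  move/eqP: y1; rewrite eqr_norml ler01 andbT => /orP[] /eqP ->.
    exact: Or42.
  exact: Or41.
have yy : -1 <= y <= 1 by rewrite -ler_norml ltW.
split; first by split=> //=; case: z0 => ->; rewrite lexx ?andbT /= ltW.
by case: z0 => ->; [exact: Or43|exact: Or44].
Qed.

Lemma edges_S0 p : edges rho p -> S0 rho p.
Proof. by case/edges_bdS0. Qed.

Lemma outer_normal_neq0 p : edges rho p -> outer_normal p != 0.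
Proof.
case: p => y z [[/= y1 _]|[/= y1 _]]; rewrite /outer_normal /= y1.
  rewrite ltxx; apply: contra_eq_neq y1 => -[->].
  by rewrite normr0 eq_sym oner_neq0.
by apply/eqP => -[]; case: ifP => _ /eqP; rewrite ?oppr_eq0 oner_eq0.
Qed.

Definition rotate (m : R * R) : R * R := (- m.2, m.1).

(** The conormal vector that the parametrization provides, up to length and
    orientation: the edge tangent times the normal. *)
Definition edge_conormal p := cross ('D_(rotate (outer_normal p)) f p) (n p).

Lemma edge_fluxE v p : edges rho p ->
  edge_flux f n v p = dot (v p) (edge_conormal p).
Proof.
move=> /edges_S0 Sp; rewrite /edge_flux /edge_conormal (derive_plane _ (surf_sub surf Sp)).
rewrite /flux_y /flux_z /rotate.
case: (outer_normal p) (f_y f p) (f_z f p) (n p) (v p) => a b fy fz np vp /=.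
by rewrite !tripleE dotE !vec3E !mxE; ring.
Qed.

Section Conormal.
Variable nu : R * R -> 'cV[R]_3.
Hypothesis hnu : outward_conormal rho f nu.

Lemma conormal_unit p : edges rho p -> dot (nu p) (nu p) = 1.
Proof. by move=> /hnu[_ /enorm1]. Qed.

Lemma conormal_normal p : edges rho p -> dot (n p) (nu p) = 0.
Proof.
move=> ep; have [[d [_ ->]] _ _] := hnu ep.
exact: (normal_tangent d (edges_S0 ep)).
Qed.

(** The conormal [nu] and [edge_conormal] are both orthogonal to the normal
    and to the edge tangent, hence parallel. *)
Lemma edge_conormalE p : edges rho p ->
  edge_conormal p = dot (nu p) (edge_conormal p) *: nu p.
Proof.
move=> ep; apply: parallel_unit; first exact: conormal_unit.
have [_ _ tnu] := hnu ep.
by rewrite /edge_conormal cross_cross dotC conormal_normal// tnu !scale0r subrr.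
Qed.

Lemma edge_conormal_neq0 p : edges rho p -> edge_conormal p != 0.
Proof.
move=> ep; have Sp := edges_S0 ep; have [n1 ny nz] := surf_normal surf Sp.
have : 'D_(rotate (outer_normal p)) f p != 0.
  apply: tangent_neq0 => //; apply: contra_neq (outer_normal_neq0 ep).
  by case: (outer_normal p) => a b [/eqP]; rewrite oppr_eq0 => /eqP -> ->.
apply: contra_neq; apply: (cross_unit_eq0 n1).
exact: (normal_tangent _ Sp).
Qed.

(** The admissible velocity on a wire is tangent to the edge, so nothing
    flows through it. *)
Lemma edge_flux_wire v p : edges rho p ->
  v p = dot (v p) (unit_tangent n nu p) *: unit_tangent n nu p ->
  edge_flux f n v p = 0.
Proof.
move=> ep vt; rewrite edge_fluxE// vt edge_conormalE// dotZl dotZr.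
have -> : dot (unit_tangent n nu p) (nu p) = 0.
  by rewrite dotC -/(triple _ _ _) triple_rot /triple crossvv dot0r.
by rewrite !mulr0.
Qed.

Lemma edge_flux_conormal v p : edges rho p -> dot (v p) (nu p) = 0 ->
  edge_flux f n v p = 0.
Proof.
by move=> ep v0; rewrite edge_fluxE// edge_conormalE// dotZr v0 mulr0.
Qed.

(** A vector orthogonal to the axis and to the circles of the cylinder is
    radial. *)
Lemma conormal_radial (x : 'cV[R]_3) p : edges rho p ->
  x 0 0 ^+ 2 + x 1 0 ^+ 2 = 1 ->
  dot (vec3 0 0 1) (edge_conormal p) = 0 ->
  dot (vec3 (- x 1 0) (x 0 0) 0) (edge_conormal p) = 0 ->
  dot (radial x) (radial x) = 1 /\ nu p = dot (radial x) (nu p) *: radial x.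
Proof.
move=> ep x1 h1 h2.
have r1 : dot (radial x) (radial x) = 1.
  by rewrite dotE !vec3E; lra.
split=> //; apply: parallel_unit => //.
have X0 := edge_conormal_neq0 ep; rewrite edge_conormalE// in X0 h1 h2.
move: X0; rewrite scaler_eq0 negb_or => /andP[k0 _].
move: h1 h2; rewrite !dotZr => /eqP; rewrite mulf_eq0 (negbTE k0) /= => /eqP h1.
move=> /eqP; rewrite mulf_eq0 (negbTE k0) /= => /eqP h2.
move: h1 h2; rewrite !dotE !vec3E.
move: (nu p) => w h1 h2.
have w2 : w 2 0 = 0 by lra.
have h3 : x 1 0 * w 0 0 = x 0 0 * w 1 0 by lra.
by apply: vec3_inj; rewrite [RHS]mxE !vec3E ?w2 ?h3; ring.
Qed.

(** The conormal points out of the surface, that is, to the same side of the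
    edge as the image of the outer normal. *)
Lemma conormal_derive p : edges rho p ->
  exists2 a : R, 0 < a & a * dot (nu p) ('D_(outer_normal p) f p) = 1.
Proof.
move=> ep; have [[d [d0 nuE]] _ tnu] := hnu ep; have Sp := edges_S0 ep.
have Up := surf_sub surf Sp.
set m := outer_normal p in d0 tnu *.
have m1 : m.1 ^+ 2 + m.2 ^+ 2 = 1.
  rewrite /m; case: p ep {nuE tnu Sp Up m d0} => y z [[/= y1 _]|[/= y1 _]];
    rewrite /outer_normal /= y1 ?ltxx /=.
    by rewrite expr0n addr0 -real_normK ?num_real// y1 expr1n.
  by rewrite expr0n add0r; case: ifP => _; rewrite ?sqrrN expr1n.
exists (d.1 * m.1 + d.2 * m.2) => //.
have nn := conormal_unit ep.
have dd : dot (nu p) ('D_d f p) = 1 by rewrite -nuE.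
have t0 := etrans (esym (dot_derive (nu p) (- m.2, m.1) Up)) tnu.
have dd1 := etrans (esym (dot_derive (nu p) d Up)) dd.
apply: (etrans (congr1 ( *%R _) (dot_derive (nu p) m Up))).
exact: (rotated_frame m1 t0 dd1).
Qed.

End Conormal.
End EdgeGeometry.

(** * Consequences of criticality *)

Section WireSegments.
Context {R : realType} (rho theta0 : R).

Lemma closed_segment (c u : 'cV[R]_3) :
  closed [set c + s *: u | s in [set s : R | `|s| <= 1]].
Proof.
apply: compact_closed; first exact: norm_hausdorff.
have -> : [set s : R | `|s| <= 1] = `[-1, 1]%classic.
  by apply/seteqP; split=> s /=; rewrite in_itv/= ler_norml.
apply: continuous_compact; last exact: segment_compact.
apply: continuous_subspaceT => s; apply: cvgD; first exact: cvg_cst.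
by apply: cvgZr_tmp; exact: cvg_id.
Qed.

Definition wire_dir1 : 'cV[R]_3 := vec3 0 1 0.
Definition wire_dir2 : 'cV[R]_3 := vec3 (- sin theta0) (cos theta0) 0.

Lemma W1E : W1 = [set 0 + s *: wire_dir1 | s in [set s : R | `|s| <= 1]].
Proof.
by apply: eq_imagel => s _; apply: vec3_inj; rewrite ![in RHS]mxE !vec3E /=; ring.
Qed.

Lemma W2E : W2 rho theta0 =
  [set vec3 0 0 rho + s *: wire_dir2 | s in [set s : R | `|s| <= 1]].
Proof.
by apply: eq_imagel => s _; apply: vec3_inj; rewrite ![in RHS]mxE !vec3E /=; ring.
Qed.

Lemma closed_Wires : closed (Wires rho theta0).
Proof. by apply: closedU; rewrite ?W1E ?W2E; exact: closed_segment. Qed.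

End WireSegments.

Section Criticality.
Context {R : realType} (rho theta0 sigma : R) (sigma_gt0 : 0 < sigma).
Variables (f n nu : R * R -> 'cV[R]_3) (U : set (R * R)).
Hypothesis surf : oriented_surface rho f n U.
Hypothesis hnu : outward_conormal rho f nu.
Hypothesis Ycyl : Y rho theta0 f `<=` cylinder rho.
Local Opaque Ck derive.

Let mu : {sigma_finite_measure set (measurableTypeR R) -> \bar R} := @lebesgue_measure R.
Let rho0 := surf_rho surf.

(** Near an edge point the boundary is a single straight edge. *)
Lemma outer_normal_near p0 : edges rho p0 ->
  \forall q \near p0, bdS0 rho q -> edges rho q /\ outer_normal q = outer_normal p0.
Proof.
have c1 (p : R * R) : (fun q : R * R => q.1) @ p --> p.1 by exact: cvg_fst.
have c2 (p : R * R) : (fun q : R * R => q.2) @ p --> p.2 by exact: cvg_snd.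
case: p0 => y z [[/= y1 /andP[z1 z2]]|[/= y1 z0]].
- have q1 : \forall q \near (y, z), `|q.1 - y| < 1.
    by have /cvgrPdistC_lt := c1 (y, z); apply.
  have q2 : \forall q \near (y, z), 0 < q.2 by exact: (cvgr_gt _ (c2 (y, z))).
  have q3 : \forall q \near (y, z), q.2 < rho by exact: (cvgr_lt _ (c2 (y, z))).
  apply: filterS3 q1 q2 q3 => -[y' z'] /= n1 n2 n3 [_ /= h].
  have yE : y' = y.
    move: y1 n1 => /eqP; rewrite eqr_norml ler01 andbT ltr_norml.
    by case: h => /= hz /orP[] /eqP yE /andP[a b]; lra.
  rewrite yE; have n23 : 0 < z' < rho by rewrite n2.
  by have [? ->] := edge_lateral y1 n23; have [_ ->] := edge_lateral y1 (introT andP (conj z1 z2)).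
- have q1 : \forall q \near (y, z), `|q.1| < 1.
    exact: (cvgr_lt _ (cvg_norm (c1 (y, z))) _ y1).
  have q2 : \forall q \near (y, z), `|q.2 - z| < rho.
    by have /cvgrPdistC_lt := c2 (y, z); apply.
  apply: filterS2 q1 q2 => -[y' z'] /= n1 n2 [_ /= h].
  have zE : z' = z.
    move: n1 n2; rewrite !ltr_norml => /andP[a b] /andP[c d].
    by case: h z0 => /= hz [] z0; lra.
  by rewrite zE; have [? ->] := edge_horizontal n1 z0; have [_ ->] := edge_horizontal y1 z0.
Qed.

(** For a critical surface the boundary term and the curvature term of the
    first variation agree. *)
Lemma critical_balance v : critical_point rho theta0 f n sigma nu ->
  admissible_velocity rho theta0 f n nu v ->
  total_flux rho f n v =
  Rintegral (mu \x mu)%E (S0 rho) (fun p => dot (v p) (n p) * normal_bending f n p).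
Proof.
move=> crit hv; have [[Uv [oUv S0Uv cv]] _ _] := hv.
have [eps e2 epsE] := orientation surf.
have := crit v hv; rewrite (first_variationE surf oUv S0Uv cv sigma epsE).
move=> /eqP; rewrite mulf_eq0 => /orP[|]; last by rewrite subr_eq0 => /eqP.
by rewrite mulf_eq0 gt_eqF//= -sqrf_eq0 e2 oner_eq0.
Qed.

Lemma bdS0_not_interior p : bdS0 rho p -> ~ intS0 rho p.
Proof.
by case: p => y z [_ /= h] [/= /andP[y1 y2] /andP[z1 z2]]; case: h => /= h; lra.
Qed.

(** Velocities with constant direction, since the normal itself is of class
    C^1 only. *)
Lemma localized_normal_velocity (N : set (R * R)) p0 (c : 'cV[R]_3) : nbhs p0 N ->
  N `<=` intS0 rho -> exists phi : R * R -> R,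
  [/\ Ck 2 setT phi, forall p, 0 <= phi p, 0 < phi p0, forall p, ~ N p -> phi p = 0 &
     admissible_velocity rho theta0 f n nu (fun q => phi q *: c)].
Proof.
move=> nN Nint; have [phi [cphi phi0 phip0 phiN]] := bump_function nN.
have v0 p : bdS0 rho p -> phi p *: c = 0.
  by move=> bp; rewrite phiN ?scale0r// => /Nint; exact: bdS0_not_interior bp.
exists phi; split=> //; split.
- by exists setT; split=> //; [exact: openT|exact: (Ck_scalel _ openT cphi)].
- by move=> p ep _; rewrite (v0 p (edges_bdS0 surf ep)) dot0l scale0r.
- by move=> p bp _; rewrite (v0 p bp) dot0l.
Qed.

(** If the curvature did not vanish at an interior point, a velocity along
    the normal at that point, cut off where the integrand keeps its sign,
    would make the curvature term nonzero and the boundary term zero. *)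
Lemma critical_bending : critical_point rho theta0 f n sigma nu ->
  forall p, S0 rho p -> normal_bending f n p = 0.
Proof.
move=> crit; have oU := surf_open surf; have S0U := surf_sub surf.
have cn := CkW (surf_normal_C1 surf).
have cK := normal_bending_C0 surf.
apply: (eq0_on_S0 rho0) => [p Sp|p0 ip0].
  exact: (Ck_continuous cK (S0U _ Sp)).
apply/eqP/negP => /negP K0.
have Sp0 := intS0_sub ip0; have [n1 _ _] := surf_normal surf Sp0.
(* The integrand of the curvature term for the velocity [K *: n p0], with [K] the
   bending at [p0]; its value at [p0] is [K ^+ 2]. *)
pose g q := normal_bending f n p0 * dot (n p0) (n q) * normal_bending f n q.
have cg : Ck 0 U g.
  apply: (Ck_mul oU _ cK); apply: (Ck_mul oU (Ck_cst _ _ _)).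
  exact: (Ck_dot oU (Ck_cst _ _ _) cn).
have gp0 : 0 < g p0 by rewrite /g n1 mulr1 -expr2 exprn_even_gt0.
have gN : \forall q \near p0, 0 < g q.
  exact: (cvgr_gt _ (Ck_continuous cg (S0U _ Sp0)) _ gp0).
pose N := [set q | intS0 rho q /\ 0 < g q].
have nN : nbhs p0 N by exact: (filterI (nbhs_intS0 ip0) gN).
have [phi [cphi phi0 phip0 phiN hv]] :=
  localized_normal_velocity (normal_bending f n p0 *: n p0) nN (fun q h => proj1 h).
have := critical_balance crit hv; set v := fun q => phi q *: _.
have -> : total_flux rho f n v = 0.
  have cv : Ck 2 setT v by exact: (Ck_scalel _ openT cphi).
  apply: (total_flux_eq0 surf openT _ cv) => // p ep.
  rewrite (edge_fluxE surf _ ep) /v phiN ?scale0r ?dot0l// => -[ip _].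
  exact: (bdS0_not_interior (edges_bdS0 surf ep) ip).
have E q : dot (v q) (n q) * normal_bending f n q = phi q * g q.
  by rewrite /v !dotZl /g !mulrA.
under eq_Rintegral do rewrite E.
have cphig : Ck 0 U (fun q => phi q * g q).
  apply: (Ck_mul oU _ cg); apply: (Ck_subset (@subsetT _ U)).
  exact: (CkW (CkW cphi)).
move=> /esym/eqP; apply/negP; rewrite gt_eqF// S0E.
have [p1 p2] := ip0.
apply: (Rintegral_rect_gt0 oU _ cphig _ p1 p2); first by rewrite -S0E.
  move=> q _; have [[_ /ltW gq]|Nq] := pselect (N q); first exact: mulr_ge0.
  by rewrite phiN// mul0r.
exact: mulr_gt0.
Qed.

(** A field [w] tangent to all the coaxial cylinders becomes admissible when
    it is multiplied by a bump function that vanishes on the wires. A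
    support on which its flux keeps its sign turns the vanishing of the
    boundary term into a pointwise statement. *)
Lemma critical_edge_test (w : R * R -> 'cV[R]_3) p0 :
  critical_point rho theta0 f n sigma nu -> Ck 2 U w ->
  (forall q, dot (w q) (radial (f q)) = 0) ->
  edges rho p0 -> Y rho theta0 f (f p0) -> dot (w p0) (edge_conormal f n p0) = 0.
Proof.
move=> crit cw wr ep0 Yp0; have oU := surf_open surf; have S0U := surf_sub surf.
have Sp0 := edges_S0 surf ep0.
rewrite -(edge_fluxE surf w ep0); set s := edge_flux f n w p0.
apply/eqP/negP => /negP s0.
pose m0 := outer_normal p0.
(* The flux density of [s *: w], with the outer normal frozen at [p0]; its value
   at [p0] is [s ^+ 2]. *)
pose G q := s * (m0.1 * flux_y f n w q + m0.2 * flux_z f n w q).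
have oUU : open (U `&` U) by exact: openI.
have cG : Ck 0 (U `&` U) G.
  apply: (Ck_mul oUU (Ck_cst _ _ _)); apply: (Ck_add oUU);
    apply: (Ck_mul oUU (Ck_cst _ _ _)).
    exact: (CkW (flux_y_C1 surf oU cw)).
  exact: (CkW (flux_z_C1 surf oU cw)).
have Gp0 : 0 < G p0 by rewrite /G -[X in s * X]/s -expr2 exprn_even_gt0.
have UUp0 : (U `&` U) p0 by split; exact: S0U.
have GN : \forall q \near p0, 0 < G q.
  exact: (cvgr_gt _ (Ck_continuous cG UUp0) _ Gp0).
have WN : \forall q \near p0, ~ Wires rho theta0 (f q).
  have cf : {for p0, continuous f}.
    exact: (Ck_continuous (surf_C2 surf) (S0U _ Sp0)).
  have oW : open (~` Wires rho theta0) by exact/closed_openC/closed_Wires.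
  by apply: (cf (~` Wires rho theta0)); apply: open_nbhs_nbhs; split=> //; case: Yp0.
pose N := [set q | (bdS0 rho q -> edges rho q /\ outer_normal q = m0) /\
  ~ Wires rho theta0 (f q) /\ 0 < G q].
have nN : nbhs p0 N.
  exact: (filterI (outer_normal_near ep0) (filterI WN GN)).
have [phi [cphi phi0 phip0 phiN]] := bump_function nN.
pose v q := (phi q * s) *: w q.
have cphiU : Ck 2 U phi by apply: Ck_subset cphi.
have cv : Ck 2 U v.
  exact: (Ck_scale oU (Ck_mul oU cphiU (Ck_cst _ _ _)) cw).
have hv : admissible_velocity rho theta0 f n nu v.
  split.
  - by exists U.
  - move=> q eq Wq; rewrite (_ : v q = 0) ?dot0l ?scale0r//.
    by rewrite /v phiN ?mul0r ?scale0r// => -[_ []].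
  - by move=> q _ _; rewrite /v dotZl wr mulr0.
have fluxE q : edge_flux f n v q = phi q * (s * edge_flux f n w q).
  have aux (m1 m2 t a b : R) : m1 * (t * s * a) + m2 * (t * s * b) =
    t * (s * (m1 * a + m2 * b)) by ring.
  have fy : flux_y f n v q = phi q * s * flux_y f n w q by exact: dotZl.
  have fz : flux_z f n v q = phi q * s * flux_z f n w q by exact: dotZl.
  by rewrite /edge_flux fy fz; exact: aux.
have Nflux q : edges rho q -> N q -> s * edge_flux f n w q = G q.
  by move=> /(edges_bdS0 surf) bq [/(_ bq)[_ mq] _]; rewrite /edge_flux mq.
have := total_flux_gt0 surf oU S0U cv (p0 := p0).
rewrite (critical_balance crit hv) /=.
have -> : Rintegral (mu \x mu)%E (S0 rho)
    (fun p => dot (v p) (n p) * normal_bending f n p) = 0.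
  transitivity (Rintegral (mu \x mu)%E (S0 rho) (fun=> 0)).
    by apply: eq_Rintegral => q /set_mem Sq; rewrite critical_bending// mulr0.
  by rewrite Rintegral_cst ?mul0r// S0E; exact: rect_measurable.
rewrite ltxx => H; suff: false by []; apply: H => //.
- move=> q eq; rewrite fluxE; have [Nq|Nq] := pselect (N q); last by rewrite phiN// mul0r.
  by rewrite (Nflux q eq Nq); apply: (mulr_ge0 (phi0 q)); case: Nq => _ [_ Gq]; exact: (ltW Gq).
- by rewrite fluxE -/s; apply: (mulr_gt0 phip0); rewrite -expr2 exprn_even_gt0.
Qed.

(** The fields of the preceding lemma given by translation along the axis
    and by rotation about it span the tangent planes of the cylinder, so the
    conormal is radial, up to its sign. *)
Lemma critical_conormal p0 : critical_point rho theta0 f n sigma nu ->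
  edges rho p0 -> Y rho theta0 f (f p0) ->
  dot (radial (f p0)) (radial (f p0)) = 1 /\
  nu p0 = dot (radial (f p0)) (nu p0) *: radial (f p0).
Proof.
move=> crit ep0 Yp0; have [x1 _] := Ycyl Yp0; have oU := surf_open surf.
have cf i := Ck_coord i 0 oU (surf_C2 surf).
have c0 : Ck 2 U (fun=> 0 : R) by exact: Ck_cst.
apply: (conormal_radial surf hnu ep0 x1).
  apply: (critical_edge_test (w := fun=> vec3 0 0 1) crit _ _ ep0 Yp0).
    exact: Ck_cst.
  by move=> q; rewrite dotE !vec3E; ring.
apply: (critical_edge_test (w := fun q => vec3 (- f q 1 0) (f q 0 0) 0) crit _ _ ep0 Yp0).
  exact: (Ck_vec3 oU (Ck_opp oU (cf 1)) (cf 0) c0).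
by move=> q; rewrite dotE !vec3E; ring.
Qed.

End Criticality.

(** * One-sided derivatives and the inverse parametrization *)

Section FrequentSign.
Context {R : realType}.

Definition frequently_right (A : set R) : Prop :=
  forall e : R, 0 < e -> exists2 t, 0 < t < e & A t.

Lemma frequently_rightPn (A : set R) :
  ~ frequently_right A -> exists2 e, 0 < e & forall t, 0 < t < e -> ~ A t.
Proof.
move=> h; apply: contrapT => h'; apply: h => e e0; apply: contrapT => h''; apply: h'.
by exists e => // t te At; apply: h''; exists t.
Qed.

Lemma frequently_right_near (A : set R) (P : R -> Prop) : frequently_right A ->
  (\forall t \near (0 : R)^'+, P t) -> exists2 t, 0 < t & A t /\ P t.
Proof.
move=> fA; rewrite near_withinE => /nbhs_ballP[e /= e0 he].
have [t /andP[t0 te] At] := fA e e0; exists t => //; split=> //; apply: he => //.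
by rewrite /ball /= sub0r normrN gtr0_norm.
Qed.

(** The hypothesis is about a set of increments that only accumulates at
    [0], because the points where a curve meets a wire are not known to fill
    an interval. *)
Lemma derive_le0_of_frequently (V : normedModType R) (g : V -> R) (q d : V) :
  derivable g q d -> frequently_right [set t | g (t *: d + q) <= g q] ->
  'D_d g q <= 0.
Proof.
move=> dg fg; rewrite leNgt; apply/negP => D0.
have cv : (fun h => h^-1 *: (g (h *: d + q) - g q)) @ 0^'+ --> 'D_d g q.
  exact: (cvg_dnbhs_at_right dg).
have near_pos : \forall t \near 0^'+, 0 < t^-1 *: (g (t *: d + q) - g q).
  exact: (cvgr_gt _ cv _ D0).
have [t t0 [/= gt]] := frequently_right_near fg near_pos.
by rewrite pmulr_rgt0 ?invr_gt0// subr_gt0 ltNge gt.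
Qed.

End FrequentSign.

Section InverseContinuity.
Context {R : realType} (rho : R) (f : R * R -> 'cV[R]_3).
Hypotheses (cf : forall p, S0 rho p -> {for p, continuous f})
  (injf : {in S0 rho &, injective f}).

(** A continuous injection of a compact set is a homeomorphism onto its
    image. *)
Lemma inverse_continuous q (N : set (R * R)) : S0 rho q -> nbhs q N ->
  \forall x \near f q, forall p, S0 rho p -> f p = x -> N p.
Proof.
move=> Sq /nbhs_ballP[e /= e0 he].
pose K := S0 rho `&` ~` ball q e.
have cK : compact K.
  apply: compact_closedI.
    by rewrite S0E; apply: rect_compact.
  by apply: open_closedC; exact: ball_open.
have cfK : closed (f @` K).
  apply: compact_closed; first exact: norm_hausdorff.
  apply: continuous_compact => //.
  by apply: continuous_in_subspaceT => p /set_mem[Sp _]; exact: cf.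
have : nbhs (f q) (~` (f @` K)).
  apply: open_nbhs_nbhs; split; first exact: closed_openC.
  move=> [p [Sp Bp] fpq]; apply: Bp.
  rewrite (injf (mem_set Sp) (mem_set Sq) fpq); exact: ballxx.
apply: filterS => x Kx p Sp fpx; apply: he; apply: contrapT => Bp.
by apply: Kx; exists p.
Qed.

End InverseContinuity.

Section Axes.
Context {R : realType} (rho : R).

Definition axis_direction : set (R * R) :=
  [set d | [\/ d = (1, 0), d = (-1, 0), d = (0, 1) | d = (0, -1)]].

(** Two nearby boundary points of a rectangle lie on a common side. *)
Lemma boundary_near_axis (q : R * R) :
  \forall p \near q, bdS0 rho p -> p.1 = q.1 \/ p.2 = q.2.
Proof.
have c1 : (fun p : R * R => p.1) @ q --> q.1 by exact: cvg_fst.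
have c2 : (fun p : R * R => p.2) @ q --> q.2 by exact: cvg_snd.
have n1 (a : R) : \forall p \near q, p.1 = a -> p.1 = q.1.
  have [qa|aq] := eqVneq q.1 a.
    by near=> p; rewrite qa.
  have e0 : 0 < `|a - q.1| by rewrite normr_gt0 subr_eq0 eq_sym.
  have /cvgrPdistC_lt/(_ _ e0) := c1.
  by apply: filterS => p /= + pa; rewrite pa ltxx.
have n2 (a : R) : \forall p \near q, p.2 = a -> p.2 = q.2.
  have [qa|aq] := eqVneq q.2 a.
    by near=> p; rewrite qa.
  have e0 : 0 < `|a - q.2| by rewrite normr_gt0 subr_eq0 eq_sym.
  have /cvgrPdistC_lt/(_ _ e0) := c2.
  by apply: filterS => p /= + pa; rewrite pa ltxx.
near=> p => -[_ [|||]] h; [left|left|right|right]; move: h; near: p; exact: n1 || exact: n2.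
Unshelve. all: by end_near. Qed.

End Axes.

(** * The ends of the wires *)

Section WireEnds.
Context {R : realType} (rho theta0 : R).
Variables (f n : R * R -> 'cV[R]_3) (U : set (R * R)).
Hypothesis surf : oriented_surface rho f n U.
Hypothesis injf : {in S0 rho &, injective f}.
Hypothesis wires_bd : Wires rho theta0 `<=` bdS rho f.
Hypothesis Ycyl : Y rho theta0 f `<=` cylinder rho.
Local Opaque Ck derive.

(** A wire with middle [c] on the axis of the cylinder, and [c + u] as one
    of its two ends. *)
Record wire_end (c u : 'cV[R]_3) : Prop := WireEnd {
  wire_center0 : c 0 0 = 0;
  wire_center1 : c 1 0 = 0;
  wire_dir_horizontal : u 2 0 = 0;
  wire_dir_unit : u 0 0 ^+ 2 + u 1 0 ^+ 2 = 1;
  wire_points : forall s : R, `|s| <= 1 -> Wires rho theta0 (c + s *: u) }.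

Lemma wire_end1 (b : bool) : wire_end 0 ((-1) ^+ b *: wire_dir1).
Proof.
split; rewrite ?mxE ?vec3E ?mulr0 ?mulr1 ?expr0n ?add0r //; first exact: sqrr_sign.
move=> s s1; left; rewrite W1E; exists (s * (-1) ^+ b); last by rewrite scalerA.
by rewrite /= normrM normrX normrN1 expr1n mulr1.
Qed.

Lemma wire_end2 (b : bool) : wire_end (vec3 0 0 rho) ((-1) ^+ b *: wire_dir2 theta0).
Proof.
split; rewrite ?mxE ?vec3E ?mulr0 //=.
  by rewrite !exprMn sqrr_sign !mul1r sqrrN addrC cos2Dsin2.
move=> s s1; right; rewrite W2E; exists (s * (-1) ^+ b); last by rewrite scalerA.
by rewrite /= normrM normrX normrN1 expr1n mulr1.
Qed.

Lemma Wires_end x : Wires rho theta0 x ->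
  exists c u, wire_end c u /\ exists2 s : R, `|s| <= 1 & x = c + s *: u.
Proof.
case=> [|]; rewrite ?W1E ?W2E => -[s s1 <-].
  exists 0, wire_dir1; have := wire_end1 false; rewrite expr0 scale1r; split=> //.
  by exists s.
exists (vec3 0 0 rho), (wire_dir2 theta0).
by have := wire_end2 false; rewrite expr0 scale1r; split=> //; exists s.
Qed.

(** The distance of a wire point to the axis is its parameter, so the wires
    meet the cylinder at their ends only. *)
Lemma axial_distance (c u : 'cV[R]_3) (s : R) : wire_end c u ->
  (c + s *: u) 0 0 ^+ 2 + (c + s *: u) 1 0 ^+ 2 = s ^+ 2.
Proof.
case=> c0 c1 _ u1 _; rewrite !mxE c0 c1 !add0r !exprMn -mulrDr u1.
by rewrite mulr1.
Qed.

Lemma boundary_in_cylinder p : bdS0 rho p ->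
  f p 0 0 ^+ 2 + f p 1 0 ^+ 2 <= 1.
Proof.
move=> bp; have [Wp|Wp] := pselect (Wires rho theta0 (f p)).
  have [c [u [cu [s s1 ->]]]] := Wires_end Wp.
  by rewrite (axial_distance s cu) -real_normK ?num_real// expr_le1.
have Yp : Y rho theta0 f (f p) by split=> //; exists p.
by have [-> _] := Ycyl Yp.
Qed.

(** The end of a wire is the farthest boundary point in the direction of the
    wire. *)
Lemma boundary_dot_le1 (c u : 'cV[R]_3) p : wire_end c u -> bdS0 rho p -> dot u (f p) <= 1.
Proof.
move=> [_ _ u2 u1 _] /boundary_in_cylinder; rewrite dotE u2 mul0r addr0 => fp.
have := sqr_ge0 (u 0 0 - f p 0 0); have := sqr_ge0 (u 1 0 - f p 1 0).
by move: u1 fp; move: (u 0 0) (u 1 0) (f p 0 0) (f p 1 0) => a b x y *; nra.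
Qed.

Lemma dot_wire (c u : 'cV[R]_3) (s : R) : wire_end c u -> dot u (c + s *: u) = s.
Proof.
move=> [c0 c1 u2 u1 _]; rewrite dotE !mxE c0 c1 u2.
by rewrite -[RHS]mulr1 -u1; ring.
Qed.

(** The preimages of the wire points near an end converge to the preimage
    [q] of that end and lie on the sides of the rectangle through [q], so
    infinitely many of them lie on one of the four axis rays from [q]. *)
Lemma wire_ray (c u : 'cV[R]_3) q : wire_end c u -> S0 rho q -> f q = c + u ->
  exists2 d, axis_direction d &
    frequently_right [set t | bdS0 rho (t *: d + q) /\
      exists2 s : R, `|s| <= 1 /\ s < 1 & f (t *: d + q) = c + s *: u].
Proof.
move=> cu Sq fq.
pose A d := [set t : R | bdS0 rho (t *: d + q) /\
  exists2 s : R, `|s| <= 1 /\ s < 1 & f (t *: d + q) = c + s *: u].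
apply: contrapT => nray.
have none d : axis_direction d -> exists2 e : R, 0 < e & forall t, 0 < t < e -> ~ A d t.
  by move=> ad; apply: frequently_rightPn => fr; apply: nray; exists d.
have [e1 e1p n1] := none (1, 0) (Or41 _ _ _ erefl).
have [e2 e2p n2] := none (-1, 0) (Or42 _ _ _ erefl).
have [e3 e3p n3] := none (0, 1) (Or43 _ _ _ erefl).
have [e4 e4p n4] := none (0, -1) (Or44 _ _ _ erefl).
pose e := Num.min (Num.min e1 e2) (Num.min e3 e4).
have e0 : 0 < e by rewrite !lt_min e1p e2p e3p e4p.
have [le1 [le2 [le3 le4]]] : e <= e1 /\ e <= e2 /\ e <= e3 /\ e <= e4.
  by rewrite /e !ge_min !lexx !orbT.
have cf p : S0 rho p -> {for p, continuous f}.
  by move=> Sp; exact: (Ck_continuous (surf_C2 surf) (surf_sub surf Sp)).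
have bqe : \forall p \near q, ball q e p by exact: nbhsx_ballx.
have nq : nbhs q [set p | ball q e p /\ (bdS0 rho p -> p.1 = q.1 \/ p.2 = q.2)].
  exact: (filterI bqe (boundary_near_axis rho q)).
have inv := inverse_continuous cf injf Sq nq.
have cs : (fun s : R => c + s *: u) @ 1^'- --> f q.
  apply: cvg_at_left_filter; rewrite fq -[X in _ + X]scale1r.
  by apply: cvgD; [exact: cvg_cst|apply: cvgZr_tmp; exact: cvg_id].
(* A wire point close enough to the end, so that its preimage is on a ray from
   [q] and closer to [q] than all four forbidden bounds. *)
have : \forall s \near (1 : R)^'-, [/\ 0 < s, s < 1 & forall p, S0 rho p -> f p = c + s *: u ->
    ball q e p /\ (bdS0 rho p -> p.1 = q.1 \/ p.2 = q.2)].
  near=> s; split; near: s.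
  - exact: nbhs_left_gt.
  - exact: nbhs_left_lt.
  - exact: cs inv.
move=> /filter_ex[s [s0 s1 hs]].
have s1' : `|s| <= 1 by rewrite ger0_norm ltW.
have [p bp fp] := wires_bd (wire_points cu s1').
have [Sp _] := bp.
have [[/= pq1 pq2] /(_ bp) ax] := hs p Sp fp.
have pq : p <> q.
  move=> pq; move: fp; rewrite pq fq => /addrI us.
  have : s = 1; last by move=> s11; rewrite s11 ltxx in s1.
  have := dot_wire s cu; rewrite -us -[X in c + X]scale1r dot_wire//.
have wit d t : axis_direction d -> t *: d + q = p -> A d t.
  by move=> ad E; rewrite /A /= E; split=> //; exists s.
have hit d t e' : axis_direction d -> t *: d + q = p -> 0 < t < e -> e <= e' ->
    (forall t, 0 < t < e' -> ~ A d t) -> False.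
  move=> ad E /andP[t0 te] ee' nA; apply: (nA t); last exact: wit.
  by rewrite t0 (lt_le_trans te ee').
move: pq1 pq2; rewrite /ball /= !ltr_norml => /andP[y1 y2] /andP[z1 z2].
clear wit hs inv nq bqe cs bp fp Sp none nray; move: y1 y2 z1 z2 ax pq hit.
clear Sq fq; subst A; case: p => y z; case: q n1 n2 n3 n4 => y' z' n1 n2 n3 n4 /=.
move=> y1 y2 z1 z2 ax pq hit.
case: ax => E; rewrite {}E in y1 y2 z1 z2 pq hit *.
- have [zz|zz|zz] := ltgtP z z'; last by apply: pq; rewrite zz.
  + apply: (hit (0, -1) (z' - z) e4 (Or44 _ _ _ erefl) _ _ le4 n4).
      by rewrite pair_dzN; congr pair; ring.
    by apply/andP; split; lra.
  + apply: (hit (0, 1) (z - z') e3 (Or43 _ _ _ erefl) _ _ le3 n3).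
      by rewrite pair_dz; congr pair; ring.
    by apply/andP; split; lra.
- have [yy|yy|yy] := ltgtP y y'; last by apply: pq; rewrite yy.
  + apply: (hit (-1, 0) (y' - y) e2 (Or42 _ _ _ erefl) _ _ le2 n2).
      by rewrite pair_dyN; congr pair; ring.
    by apply/andP; split; lra.
  + apply: (hit (1, 0) (y - y') e1 (Or41 _ _ _ erefl) _ _ le1 n1).
      by rewrite pair_dy; congr pair; ring.
    by apply/andP; split; lra.
Unshelve. all: by end_near. Qed.

End WireEnds.

(** * The corners of the rectangle *)

Section Corners.
Context {R : realType} (rho theta0 : R).
Variables (f n : R * R -> 'cV[R]_3) (U : set (R * R)).
Hypothesis surf : oriented_surface rho f n U.
Hypothesis injf : {in S0 rho &, injective f}.
Hypothesis wires_bd : Wires rho theta0 `<=` bdS rho f.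
Hypothesis Ycyl : Y rho theta0 f `<=` cylinder rho.
Local Opaque Ck derive.

Let rho0 := surf_rho surf.

Lemma axis_direction_neq0 (d : R * R) : axis_direction d -> d != 0.
Proof.
have n10 : (1 : R) != 0 by exact: oner_neq0.
by case=> ->; apply/eqP => -[] /eqP; rewrite ?oppr_eq0 (negbTE n10).
Qed.

Lemma dot_f_derive (w : 'cV[R]_3) (d q : R * R) : S0 rho q ->
  derivable (fun p => dot w (f p)) q d /\
  'D_d (fun p => dot w (f p)) q = dot w ('D_d f q).
Proof.
move=> Sq; have Uq := surf_sub surf Sq; have oU := surf_open surf.
have cw : Ck 2 U (fun p => dot w (f p)).
  exact: (Ck_dot oU (Ck_cst _ _ _) (surf_C2 surf)).
have dw := Ck_differentiable cw Uq.
have df := Ck_differentiable (surf_C2 surf) Uq.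
split; first exact: diff_derivable.
have := derive_dot (derivable_cst w q d) (diff_derivable (v := d) df).
by rewrite derive_cst dot0l add0r.
Qed.

(** The derivative along such a ray is a limit of difference quotients all
    parallel to [u], and the surface is regular. *)
Lemma wire_ray_derivative (c u : 'cV[R]_3) (d q : R * R) :
  wire_end rho theta0 c u -> S0 rho q -> f q = c + u -> axis_direction d ->
  frequently_right [set t | bdS0 rho (t *: d + q) /\
    exists2 s : R, `|s| <= 1 /\ s < 1 & f (t *: d + q) = c + s *: u] ->
  dot u ('D_d f q) < 0 /\ 'D_d f q = dot u ('D_d f q) *: u.
Proof.
move=> cu Sq fq ad fr.
have sign w : (forall s : R, s < 1 -> dot w (c + s *: u) <= dot w (c + u)) ->
    dot w ('D_d f q) <= 0.
  move=> hw; have [dw <-] := dot_f_derive w d Sq.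
  apply: derive_le0_of_frequently dw _ => e /fr[t te [_ [s [_ s1] E]]].
  by exists t => //=; rewrite E fq; exact: hw.
have uu : dot u u = 1.
  by case: cu => _ _ u2 u1 _; rewrite dotE u2 mul0r addr0 -!expr2.
have le0 : dot u ('D_d f q) <= 0.
  apply: sign => s s1; rewrite (dot_wire s cu).
  by have := dot_wire 1 cu; rewrite scale1r => ->; exact: ltW.
have T0 := tangent_neq0 surf Sq (axis_direction_neq0 ad).
have orth w : dot w u = 0 -> dot w ('D_d f q) = 0.
  move=> wu; apply/eqP; rewrite eq_le; apply/andP; split.
    by apply: sign => s _; rewrite !dotDr dotZr wu mulr0.
  rewrite -oppr_le0 -mulN1r -dotZl; apply: sign => s _.
  by rewrite !dotZl !dotDr dotZr wu mulr0.
move: ('D_d f q) T0 le0 orth => T T0 le0 orth.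
have TE : T = dot u T *: u.
  (* The component of [T] orthogonal to [u]. *)
  pose w := T + - dot u T *: u.
  have wu : dot w u = 0 by rewrite /w dotDl dotZl uu dotC mulr1 addrN.
  have w0 : w = 0.
    by apply: dot_eq0; rewrite {2}/w dotDr dotZr wu mulr0 addr0 orth.
  by apply/eqP; rewrite -subr_eq0 -scaleNr; apply/eqP.
split=> //; rewrite lt_neqAle le0 andbT.
by apply: contra_neq T0 => u0; rewrite TE u0 scale0r.
Qed.

Lemma derive_opp (d q : R * R) : S0 rho q -> 'D_(- d) f q = - 'D_d f q.
Proof.
move=> Sq; have Uq := surf_sub surf Sq.
by rewrite !(derive_plane surf _ Uq) /= !scaleNr opprD.
Qed.

(** If a ray from an edge point runs in the boundary then it runs along the
    edge, which continues on the other side. *)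
Lemma edge_ray_opposite (d q : R * R) : edges rho q -> axis_direction d ->
  frequently_right [set t | bdS0 rho (t *: d + q)] ->
  exists2 e : R, 0 < e & forall t, 0 < t < e -> bdS0 rho (t *: - d + q).
Proof.
have oppE (a b : R) : - ((a, b) : R * R) = (- a, - b) by [].
case: q => y z [[/= y1 /andP[z1 z2]]|[/= y1 z0]] ad fr.
- have yE : y = 1 \/ y = -1.
    by move/eqP: y1; rewrite eqr_norml ler01 andbT => /orP[] /eqP; [left|right].
  have good t' : 0 <= t' <= rho -> bdS0 rho (y, t').
    move=> t'r; split; last by case: yE => ->; [exact: Or42|exact: Or41].
    by split=> //=; case: yE => ->; rewrite lexx; lra.
  exists (Num.min z (rho - z)); first by rewrite lt_min z1 subr_gt0.
  move=> t; rewrite lt_min => /andP[t0 /andP[tz tr]].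
  case: ad fr => -> fr.
  + have [t' /andP[t'0 t'1] /=] := fr 1 ltr01; rewrite pair_dy => -[[/= /andP[a b] _] h].
    by exfalso; case: yE h => -> [] /= h; lra.
  + have [t' /andP[t'0 t'1] /=] := fr 1 ltr01; rewrite pair_dyN => -[[/= /andP[a b] _] h].
    by exfalso; case: yE h => -> [] /= h; lra.
  + by rewrite oppE oppr0 pair_dzN; apply: good; apply/andP; split; lra.
  + by rewrite oppE oppr0 opprK pair_dz; apply: good; apply/andP; split; lra.
- move: y1; rewrite ltr_norml => /andP[y1 y2].
  have good t' : -1 <= t' <= 1 -> bdS0 rho (t', z).
    move=> t'r; split; last by case: z0 => ->; [exact: Or43|exact: Or44].
    by split=> //=; case: z0 => ->; rewrite lexx ?andbT ltW.
  exists (Num.min (1 + y) (1 - y)); first by rewrite lt_min; apply/andP; split; lra.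
  move=> t; rewrite lt_min => /andP[t0 /andP[ty ty']].
  case: ad fr => -> fr.
  + by rewrite oppE oppr0 pair_dyN; apply: good; apply/andP; split; lra.
  + by rewrite oppE oppr0 opprK pair_dy; apply: good; apply/andP; split; lra.
  + have [t' /andP[t'0 t'1] /=] := fr rho rho0; rewrite pair_dz => -[[_ /= /andP[a b]] h].
    by exfalso; case: z0 h a b => -> [] /= h a b; lra.
  + have [t' /andP[t'0 t'1] /=] := fr rho rho0; rewrite pair_dzN => -[[_ /= /andP[a b]] h].
    by exfalso; case: z0 h a b => -> [] /= h a b; lra.
Qed.

(** At an edge point the boundary curve is smooth. If it passed through the
    end of a wire, it would enter the wire with a nonzero velocity along it
    and would leave on the other side beyond the end, out of the solid
    cylinder. *)
Lemma wire_end_not_edge (c u : 'cV[R]_3) q : wire_end rho theta0 c u -> edges rho q ->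
  f q <> c + u.
Proof.
move=> cu eq fq; have Sq := edges_S0 surf eq.
have [d ad fr] := wire_ray surf injf wires_bd cu Sq fq.
have [neg _] := wire_ray_derivative cu Sq fq ad fr.
suff : 0 <= dot u ('D_d f q) by rewrite leNgt neg.
have [dw dE] := dot_f_derive u (- d) Sq.
rewrite -oppr_le0.
have -> : - dot u ('D_d f q) = dot u ('D_(- d) f q).
  by rewrite derive_opp// -[- 'D_d f q]scaleN1r dotZr mulN1r.
rewrite -dE; apply: derive_le0_of_frequently dw _.
have small : exists2 e : R, 0 < e & forall t, 0 < t < e -> bdS0 rho (t *: - d + q).
  apply: (edge_ray_opposite eq ad) => e /fr[t te [bt _]].
  by exists t.
move=> e e0; have [e' e'0 he'] := small.
have m0 : 0 < Num.min e e' by rewrite lt_min e0.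
exists (Num.min e e' / 2).
  rewrite divr_gt0//=; apply: (@lt_le_trans _ _ (Num.min e e')).
    by rewrite ltr_pdivrMr// ltr_pMr// ltr1n.
  by rewrite ge_min lexx.
have be : bdS0 rho ((Num.min e e' / 2) *: - d + q).
  apply: he'; rewrite divr_gt0//=; apply: (@lt_le_trans _ _ (Num.min e e')).
    by rewrite ltr_pdivrMr// ltr_pMr// ltr1n.
  by rewrite ge_min lexx orbT.
rewrite /= fq; have := dot_wire 1 cu; rewrite scale1r => ->.
exact: (boundary_dot_le1 Ycyl cu be).
Qed.

Definition corner (b : bool * bool) : R * R := ((-1) ^+ b.1, if b.2 then rho else 0).

Lemma boundary_edge_or_corner p : bdS0 rho p -> edges rho p \/ exists b, p = corner b.
Proof.
case: p => y z [[/= /andP[y1 y2] /andP[z1 z2]] h].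
have [zi|zi] := pselect (0 < z < rho).
  left; left; split=> //=; case: h => /= h.
  - by rewrite h normrN1.
  - by rewrite h normr1.
  - by move: zi; rewrite h ltxx.
  - by move: zi; rewrite h ltxx andbF.
have zE : z = 0 \/ z = rho.
  have [z0|z0] := eqVneq z 0; first by left.
  have [zr|zr] := eqVneq z rho; first by right.
  by exfalso; apply: zi; rewrite !lt_neqAle eq_sym z0 z1 zr z2.
have [yi|yi] := pselect (`|y| < 1); first by left; right.
have yE : y = 1 \/ y = -1.
  have [e|y10] := eqVneq y 1; first by left.
  have [e|yN1] := eqVneq y (-1); first by right.
  by exfalso; apply: yi; rewrite ltr_norml !lt_neqAle eq_sym yN1 y1 y10 y2.
right; case: yE zE => -> [] ->.
- by exists (false, false).
- by exists (false, true).
- by exists (true, false).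
- by exists (true, true).
Qed.

Let center (b : bool) : 'cV[R]_3 := if b then vec3 0 0 rho else 0.
Let dir (b : bool) : 'cV[R]_3 := if b then wire_dir2 theta0 else wire_dir1.

Let wire_end_sign (b : bool * bool) :
  wire_end rho theta0 (center b.1) ((-1) ^+ b.2 *: dir b.1).
Proof. by case: b => -[] b2; [exact: wire_end2|exact: wire_end1]. Qed.

Let endpoint_inj (b b' : bool * bool) :
  center b.1 + (-1) ^+ b.2 *: dir b.1 = center b'.1 + (-1) ^+ b'.2 *: dir b'.1 -> b = b'.
Proof.
case: b b' => b1 b2 [b1' b2'] /= E.
have E1 : b1 = b1'.
  have height c t : (center c + t *: dir c) 2 0 = if c then rho else 0.
    by case: c; rewrite [LHS]mxE [X in _ + X]mxE /center /dir ?vec3E ?mulr0 ?addr0// mxE.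
  move: (congr1 (fun x : 'cV[R]_3 => x 2 0) E); rewrite !height => /eqP.
  have r0 : rho != 0 by rewrite gt_eqF.
  by case: (b1); case: (b1') => //; [|rewrite eq_sym]; rewrite (negbTE r0).
rewrite -{}E1 in E *; congr pair.
have := wire_end_sign (b1, false); rewrite /= expr0 scale1r => we.
have := congr1 (dot (dir b1)) E; rewrite !(dot_wire _ we).
case: b2 {E}; case: b2' => //=; rewrite expr0 expr1 => h; exfalso; lra.
Qed.

(** The four ends of the wires have distinct preimages among the four
    corners, so every corner is one of them. *)
Lemma corner_wire_end b : exists c u, wire_end rho theta0 c u /\ f (corner b) = c + u.
Proof.
have ex (e : bool * bool) : exists b, f (corner b) = center e.1 + (-1) ^+ e.2 *: dir e.1.
  have we := wire_end_sign e.
  have We : Wires rho theta0 (center e.1 + (-1) ^+ e.2 *: dir e.1).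
    by rewrite -[_ *: dir _]scale1r; apply: (wire_points we); rewrite normr1.
  have [q bq fq] := wires_bd We.
  have [eq|[b' qb]] := boundary_edge_or_corner bq.
    by case: (wire_end_not_edge we eq fq).
  by exists b'; rewrite -qb.
have [g gE] := choice ex.
have g_inj : injective g.
  by move=> e e' ee; apply: endpoint_inj; rewrite -!gE ee.
have [g' _ gK] := injF_bij g_inj.
exists (center (g' b).1), ((-1) ^+ (g' b).2 *: dir (g' b).1).
by split; [exact: wire_end_sign|rewrite -gE gK].
Qed.

Lemma corner_Wires b : Wires rho theta0 (f (corner b)).
Proof.
have [c [u [we ->]]] := corner_wire_end b.
by rewrite -[u]scale1r; apply: (wire_points we); rewrite normr1.
Qed.

(** Every edge starts at a corner [corner b] in a direction [e]; the only
    other side at that corner runs along minus the outer normal of the edge. *)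
Lemma edge_frame p : edges rho p -> exists b e L t0,
  [/\ 0 < t0 < L, p = t0 *: e + corner b,
    forall t, 0 < t < L ->
      edges rho (t *: e + corner b) /\ outer_normal (t *: e + corner b) = outer_normal p &
    forall d, axis_direction d ->
      frequently_right [set t | bdS0 rho (t *: d + corner b)] ->
      d = e \/ d = - outer_normal p].
Proof.
case: p => y z [[/= y1 zr]|[/= y1 z0]].
- have yE : y = 1 \/ y = -1.
    by move/eqP: y1; rewrite eqr_norml ler01 andbT => /orP[] /eqP; [left|right].
  have [b bE] : exists b : bool, y = (-1) ^+ b.
    by case: yE => ->; [exists false|exists true].
  exists (b, false), (0, 1), rho, z; rewrite /corner /= -bE; split=> //.
  + by rewrite pair_dz addr0.
  + move=> t tr; rewrite pair_dz addr0.
    by have [? ->] := edge_lateral y1 tr; have [_ ->] := edge_lateral y1 zr.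
  + have [_ ->] := edge_lateral y1 zr.
    have oppE : - ((y, 0) : R * R) = (- y, 0) by congr pair; exact: oppr0.
    rewrite oppE => d ad fr; case: ad fr => -> fr; [| |by left|].
    * have [t' /andP[t'0 t'1] /=] := fr 1 ltr01; rewrite pair_dy => -[[/= /andP[a b'] _] h].
      by right; congr pair; case: yE a b' h => -> a b' h; lra.
    * have [t' /andP[t'0 t'1] /=] := fr 1 ltr01; rewrite pair_dyN => -[[/= /andP[a b'] _] h].
      by right; congr pair; case: yE a b' h => -> a b' h; lra.
    * have [t' /andP[t'0 t'1] /=] := fr 1 ltr01; rewrite pair_dzN => -[[_ /= /andP[a b']] h].
      by exfalso; lra.
- have [b bE] : exists b : bool, z = if b then rho else 0.
    by case: z0 => ->; [exists false|exists true].
  have [_ nE] := edge_horizontal y1 z0.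
  exists (true, b), (1, 0), 2, (y + 1); rewrite /corner /= -bE; split=> //.
  + by move: y1; rewrite ltr_norml => /andP[a a']; apply/andP; split; lra.
  + by rewrite pair_dy; congr pair; rewrite expr1; lra.
  + move=> t /andP[ta tb]; rewrite pair_dy nE.
    have tt : `|t + (-1) ^+ true| < 1.
      by rewrite ltr_norml expr1; apply/andP; split; lra.
    by have [? ->] := edge_horizontal tt z0.
  + rewrite nE => d ad fr; case: ad fr => -> fr; [by left| | |].
    * have [t' /andP[t'0 t'1] /=] := fr 1 ltr01; rewrite pair_dyN expr1.
      by move=> -[[/= /andP[a b'] _] h]; exfalso; lra.
    * have [t' /andP[t'0 t'1] /=] := fr rho rho0; rewrite pair_dz => -[[_ /= /andP[a b']] h].
      right; case: z0 a b' => -> a b'; last by exfalso; lra.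
      by rewrite eqxx; congr pair; rewrite ?oppr0 ?opprK.
    * have [t' /andP[t'0 t'1] /=] := fr rho rho0; rewrite pair_dzN => -[[_ /= /andP[a b']] h].
      right; case: z0 a b' => -> a b'; first by exfalso; lra.
      by rewrite gt_eqF//; congr pair; rewrite ?oppr0.
Qed.

End Corners.

(** * The edges off the wires *)

Section FreeEdges.
Context {R : realType} (rho theta0 sigma : R) (sigma_gt0 : 0 < sigma).
Variables (f n nu : R * R -> 'cV[R]_3) (U : set (R * R)).
Hypothesis surf : oriented_surface rho f n U.
Hypothesis hnu : outward_conormal rho f nu.
Hypothesis injf : {in S0 rho &, injective f}.
Hypothesis wires_bd : Wires rho theta0 `<=` bdS rho f.
Hypothesis Ycyl : Y rho theta0 f `<=` cylinder rho.
Local Opaque Ck derive.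

Let rho0 := surf_rho surf.

(** Wire points on an open edge are strictly inside the cylinder, because
    the ends of the wires sit at the corners. *)
Lemma edge_wire_or_free p : edges rho p ->
  ~ Wires rho theta0 (f p) <-> f p 0 0 ^+ 2 + f p 1 0 ^+ 2 = 1.
Proof.
move=> ep; split=> [Wp|].
  have Yp : Y rho theta0 f (f p) by split=> //; exists p => //; exact: (edges_bdS0 surf).
  by have [] := Ycyl Yp.
move=> fp1 Wp; have [c [u [we [s s1 fE]]]] := Wires_end Wp.
have := axial_distance s we; rewrite -fE fp1 => /esym/eqP.
rewrite sqrf_eq1 => /orP[] /eqP sE; rewrite sE in fE.
  by apply: (wire_end_not_edge surf injf wires_bd Ycyl we ep); rewrite fE scale1r.
(* The parameter [-1] is the end of the opposite half of the wire. *)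
have we' : wire_end rho theta0 c (- u).
  case: we => c0 c1 u2 u1 wp; split=> //.
  - by rewrite mxE u2 oppr0.
  - by rewrite !mxE !sqrrN.
  - by move=> t t1; rewrite scalerN -scaleNr; apply: wp; rewrite normrN.
by apply: (wire_end_not_edge surf injf wires_bd Ycyl we' ep); rewrite fE scaleN1r.
Qed.

(** The points of an edge off the wires form a set that is open, since the
    wires are closed, and also closed, since it is where the distance to the
    axis is [1]. An edge is connected. *)
Lemma free_edge (e q : R * R) (L t0 : R) : 0 < t0 < L ->
  (forall t, 0 < t < L -> edges rho (t *: e + q)) ->
  ~ Wires rho theta0 (f (t0 *: e + q)) ->
  forall t, 0 < t < L -> ~ Wires rho theta0 (f (t *: e + q)).
Proof.
move=> t0L eE W0.
pose B := [set t : R | 0 < t < L /\ ~ Wires rho theta0 (f (t *: e + q))].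
have lc := @line_continuous R q e.
have cft t : U (t *: e + q) -> {for t, continuous (fun t : R => f (t *: e + q))}.
  move=> Ut; exact: (continuous_comp (lc t) (Ck_continuous (surf_C2 surf) Ut)).
have nU t : U (t *: e + q) -> \forall s \near t, U (s *: e + q).
  by move=> Ut; apply: (lc t); exact: open_nbhs_nbhs (conj (surf_open surf) Ut).
have StU t : 0 < t < L -> U (t *: e + q).
  by move=> /eE/(edges_S0 surf); exact: (surf_sub surf).
suff BE : B = `]0, L[%classic.
  move=> t tL; have : B t by rewrite BE /= in_itv.
  by case.
have conn : connected (`]0, L[%classic : set R).
  by apply/connected_intervalP; exact: interval_is_interval.
apply: conn.
- by exists t0.
- exists [set t : R | U (t *: e + q) /\ ~ Wires rho theta0 (f (t *: e + q))].
    rewrite openE => t [Ut Wt]; rewrite /interior.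
    apply: filterI; first exact: nU.
    have oW : open (~` Wires rho theta0) by exact/closed_openC/closed_Wires.
    by apply: (cft t Ut (~` Wires rho theta0)); exact: open_nbhs_nbhs (conj oW Wt).
  apply/seteqP; split=> t; rewrite /B /= in_itv/=.
    by move=> [tL Wt]; split=> //; split=> //; exact: StU.
  by move=> [tL [_ Wt]].
- exists (~` [set t : R | U (t *: e + q) /\
    f (t *: e + q) 0 0 ^+ 2 + f (t *: e + q) 1 0 ^+ 2 < 1]).
    apply: open_closedC; rewrite openE => t [Ut lt1]; rewrite /interior.
    apply: filterI; first exact: nU.
    have cc i : {for t, continuous (fun t : R => f (t *: e + q) i 0)}.
      have ci : {for f (t *: e + q), continuous (fun M : 'cV[R]_3 => M i 0)}.
        exact: coord_continuous.
      exact: (continuous_comp (cft t Ut) ci).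
    exact: (cvgr_lt _ (cvgD (cvgM (cc 0) (cc 0)) (cvgM (cc 1) (cc 1))) _ lt1).
  apply/seteqP; split=> t; rewrite /B /= in_itv/=.
    move=> [tL Wt]; split=> // -[_].
    by rewrite ((edge_wire_or_free (eE t tL)).1 Wt) ltxx.
  move=> [tL nlt]; split=> //; apply/(edge_wire_or_free (eE t tL)).
  apply/eqP; rewrite eq_le; apply/andP; split.
    by apply: (boundary_in_cylinder Ycyl); exact: (edges_bdS0 surf (eE t tL)).
  by rewrite leNgt; apply/negP => lt1; apply: nlt; split=> //; exact: StU.
Qed.

Lemma radial_wire_end (c u : 'cV[R]_3) : wire_end rho theta0 c u -> radial (c + u) = u.
Proof.
by case=> c0 c1 u2 _ _; apply: vec3_inj; rewrite !vec3E // mxE ?c0 ?c1 add0r.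
Qed.

(** At the corner that begins a free edge, the other side is mapped into a
    wire and so leaves the end of the wire towards the axis. Hence the outer
    normal direction of the free edge is mapped to the outward radial
    direction. *)
Lemma corner_outward (e : R * R) b (m : R * R) L :
  0 < L -> (forall t, 0 < t < L -> ~ Wires rho theta0 (f (t *: e + corner rho b))) ->
  S0 rho (corner rho b) ->
  (forall d, axis_direction d ->
      frequently_right [set t | bdS0 rho (t *: d + corner rho b)] -> d = e \/ d = - m) ->
  0 < dot (radial (f (corner rho b))) ('D_m f (corner rho b)).
Proof.
move=> L0 free Sb dirs.
have [c [u [we fb]]] := corner_wire_end surf injf wires_bd Ycyl b.
have [d ad fr] := wire_ray surf injf wires_bd we Sb fb.
have [neg _] := wire_ray_derivative surf we Sb fb ad fr.
have frb : frequently_right [set t | bdS0 rho (t *: d + corner rho b)].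
  by move=> x /fr[t tx [bt _]]; exists t.
rewrite fb radial_wire_end//.
have [de|dm] := dirs d ad frb.
  have [t /andP[t0 tL] [_ [s [s1 _] ft]]] := fr L L0.
  exfalso; apply: (free t); first by rewrite t0.
  by rewrite -de ft; exact: (wire_points we).
move: neg; rewrite dm (derive_opp surf _ Sb) -[- 'D_m f _]scaleN1r dotZr.
by rewrite mulN1r oppr_lt0.
Qed.

(** The conormal is plus or minus the radial vector along the whole edge, so
    the radial component of the derivative in the outer normal direction
    never vanishes there. It is positive at the corner, hence everywhere,
    and the sign of the conormal follows. *)
Lemma critical_conormal_outward p : critical_point rho theta0 f n sigma nu ->
  edges rho p -> Y rho theta0 f (f p) -> nu p = radial (f p).
Proof.
move=> crit ep Yp; have [_ Wp] := Yp.
have [b [e [L [t0 [t0L pE dE dirs]]]]] := edge_frame surf ep.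
set m := outer_normal p in dE dirs.
have L0 : 0 < L by case/andP: t0L; exact: lt_trans.
have eE t (tL : 0 < t < L) := (dE t tL).1.
have free : forall t, 0 < t < L -> ~ Wires rho theta0 (f (t *: e + corner rho b)).
  by apply: (free_edge t0L eE); rewrite -pE.
have Sb : S0 rho (corner rho b).
  rewrite /corner; split=> /=; first by case: b.1; rewrite ?expr0 ?expr1; apply/andP; split; lra.
  by case: b.2; rewrite lexx ltW.
have pos := corner_outward L0 free Sb dirs.
pose h q := dot (radial (f q)) ('D_m f q).
have sub t : 0 <= t <= 1 -> t *: (p - corner rho b) + corner rho b =
    (t * t0) *: e + corner rho b by rewrite {1}pE addrK scalerA.
have ch q : U q -> {for q, continuous h}.
  move=> Uq; have oU := surf_open surf; have cf := surf_C2 surf.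
  have cr : Ck 1 U (fun q => radial (f q)).
    by apply: (Ck_vec3 oU); [exact: (CkW (Ck_coord 0 0 oU cf))|
      exact: (CkW (Ck_coord 1 0 oU cf))|exact: Ck_cst].
  exact: (Ck_continuous (Ck_dot oU cr (CkD m cf)) Uq).
(* At an edge point [h] is, up to a positive factor, the inverse of the signed
   length of the conormal along the radial vector. *)
have nz t : 0 < t < L -> h (t *: e + corner rho b) != 0.
  move=> tL; have et := eE t tL.
  have Yt : Y rho theta0 f (f (t *: e + corner rho b)).
    by split; [exists (t *: e + corner rho b) => //; exact: (edges_bdS0 surf et)|exact: free].
  have [_ nuE] := critical_conormal sigma_gt0 surf hnu Ycyl crit et Yt.
  have [a a0] := conormal_derive surf hnu et.
  rewrite (dE t tL).2 nuE dotZl => aE; apply/eqP => h0.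
  by move: aE; rewrite -/(h _) h0 !mulr0 => /esym/eqP; rewrite oner_eq0.
have hp : 0 < h p.
  apply: (@sign_between R h (corner rho b) p) => // [t t01|t t01].
    by apply: ch; apply: (surf_sub surf); apply: (S0_convex t01 Sb); exact: (edges_S0 surf).
  rewrite sub//; have [t00|tn0] := eqVneq t 0.
    by rewrite t00 mul0r scale0r add0r gt_eqF.
  have /andP[tge0 tle1] := t01; have /andP[t0p t0l] := t0L.
  have tp : 0 < t by rewrite lt_neqAle eq_sym tn0.
  apply: nz; rewrite mulr_gt0//=; apply: le_lt_trans t0l.
  by rewrite ler_piMl// ltW.
have [rr nuE] := critical_conormal sigma_gt0 surf hnu Ycyl crit ep Yp.
have [a a0] := conormal_derive surf hnu ep.
have := conormal_unit hnu ep.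
rewrite {}nuE; move: (dot (radial _) (nu p)) => k.
rewrite !dotZl dotZr rr mulr1 -/m -/(h p) => kk ahk.
have k0 : 0 < k.
  have : 0 < a * (k * h p) by rewrite ahk ltr01.
  by rewrite pmulr_rgt0// pmulr_lgt0.
have -> : k = 1; last by rewrite scale1r.
move/eqP: kk; rewrite -expr2 sqrf_eq1 => /orP[] /eqP // kN; exfalso; lra.
Qed.

End FreeEdges.

(** * The characterization of critical surfaces *)

(** Under the two conditions both terms of the first variation vanish, the
    boundary term even pointwise. *)
Lemma stationary_critical (R : realType) (rho theta0 sigma : R)
    (f n nu : R * R -> 'cV[R]_3) (U : set (R * R)) :
  oriented_surface rho f n U -> outward_conormal rho f nu ->
  (forall p, S0 rho p -> normal_bending f n p = 0) ->
  (forall p, edges rho p -> Y rho theta0 f (f p) -> nu p = radial (f p)) ->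
  critical_point rho theta0 f n sigma nu.
Proof.
move=> surf hnu K0 nuY v [[Uv [oUv S0Uv cv]] vW vY].
have [eps _ epsE] := orientation surf.
rewrite (first_variationE surf oUv S0Uv cv sigma epsE) -/(total_flux rho f n v).
set bend := Rintegral _ _ _.
have -> : bend = 0.
  transitivity (Rintegral (@lebesgue_measure R \x @lebesgue_measure R)%E (S0 rho) (fun=> 0)).
    by apply: eq_Rintegral => p /set_mem Sp; rewrite K0// mulr0.
  by rewrite Rintegral_cst ?mul0r// S0E; exact: rect_measurable.
rewrite subr0 (total_flux_eq0 surf oUv S0Uv cv) ?mulr0// => p ep.
have [Wp|Wp] := pselect (Wires rho theta0 (f p)).
  by apply: (edge_flux_wire surf hnu ep); exact: vW.
have bp := edges_bdS0 surf ep.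
have Yp : Y rho theta0 f (f p) by split=> //; exists p.
by apply: (edge_flux_conormal surf hnu ep); rewrite nuY//; exact: vY.
Qed.

Theorem proposition3p1 (R : realType) (rho theta0 sigma : R)
    (rho_gt0 : 0 < rho) (theta0_ge0 : 0 <= theta0) (theta0_ltpi : theta0 < pi)
    (sigma_gt0 : 0 < sigma)
    (Surf : set 'cV[R]_3) (f n nu : R * R -> 'cV[R]_3)
    (hS : admissible rho theta0 f Surf)
    (hn : unit_normal rho f n)
    (hnu : outward_conormal rho f nu) :
  critical_point rho theta0 f n sigma nu <->
  (forall p, S0 rho p -> mean_curvature f n p = 0) /\
  (forall p, bdS0 rho p -> Y rho theta0 f (f p) -> nu p = radial (f p)).
Proof.
have [[Uf [oUf S0Uf cf]] injf reg _ [wires_bd Ycyl]] := hS.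
have [[Un [oUn S0Un cn]] hn1] := hn.
have surf : oriented_surface rho f n (Uf `&` Un).
  split=> //.
  - exact: openI.
  - by move=> p Sp; split; [exact: S0Uf|exact: S0Un].
  - by apply: Ck_subset cf => p [].
  - by apply: Ck_subset cn => p [].
  - by move=> p /hn1[/enorm1].
split=> [crit|[H0 nuY]].
  split=> [p Sp|p bp Yp].
    rewrite (mean_curvatureE surf Sp) (critical_bending sigma_gt0 surf crit Sp).
    by rewrite mul0r.
  have [ep|[b pb]] := boundary_edge_or_corner bp.
    exact: (critical_conormal_outward sigma_gt0 surf hnu injf wires_bd Ycyl crit ep Yp).
  by case: Yp => _; rewrite pb; case; exact: (corner_Wires surf injf wires_bd Ycyl).
apply: (stationary_critical sigma surf hnu) => [p Sp|p ep Yp].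
  have := jacobian3_neq0 surf Sp; have := H0 p Sp; rewrite (mean_curvatureE surf Sp).
  move: (jacobian3 f n p) (normal_bending f n p) => J K /eqP + J0.
  by rewrite mulf_eq0 invr_eq0 mulf_eq0 (negbTE J0) orbF pnatr_eq0 orbF => /eqP.
exact: nuY (edges_bdS0 surf ep) Yp.
Qed.
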